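(* For every order $r\in\{1,2,3,\ldots\}$, on the random model $(\Omega_n,P_n)$, \[ \sqrt{n}\left(\frac{S_{r+1,n}}{n}-\frac{1}{4^r}\right)\Rightarrow N\left(0,\,\frac{1}{3}\cdot\frac{4^r-1}{16^r}\right)\qquad (n\to\infty), \] where $\Rightarrow$ denotes convergence in distribution and $N(\mu,\sigma^2)$ is the normal distribution with mean $\mu$ and variance $\sigma^2$.
   Context: For $n\ge 1$, let $\Omega_n$ be the set of rooted plane (ordered) full binary trees with $n$ leaves (every internal node has exactly two children, left and right distinguished), so $|\Omega_n|=\frac{(2n-2)!}{n!(n-1)!}$. The random model is $\Omega_n$ with the uniform probability measure $P_n$. Horton–Strahler ordering: every leaf has order 1; an internal node whose two children have different orders $r_1\neq r_2$ has order $\max\{r_1,r_2\}$; an internal node whose two children both have order $r$ has order $r+1$. A branch of order $r$ is a maximal connected path consisting of nodes all of order $r$. For $\tau\in\Omega_n$, $S_{r,n}(\tau)$ denotes the number of branches of order $r$ in $\tau$ (so $S_{1,n}=n$). *)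

(* Defs.v *)
From Stdlib Require Import Bool Reals Lra List Arith.
From Coquelicot Require Import Coquelicot.
Import ListNotations.
Open Scope R_scope.

Inductive tree : Type :=
| Leaf : tree
| Node : tree -> tree -> tree.

Fixpoint leaves (t : tree) : nat :=
  match t with
  | Leaf => 1
  | Node a b => leaves a + leaves b
  end%nat.

(* trees_fuel f n: all full binary trees with n leaves and height < f,
   each listed exactly once; the root of a tree with n >= 2 leaves splits
   the leaves as k + (n - k) with 1 <= k <= n - 1. *)
Fixpoint trees_fuel (fuel n : nat) : list tree :=
  match fuel with
  | O => []
  | S f =>
      if Nat.eqb n 1 then [Leaf]
      else flat_map (fun k =>
             flat_map (fun a => map (fun b => Node a b) (trees_fuel f (n - k)%nat))
                      (trees_fuel f k))
             (seq 1 (n - 1))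
  end.

(* Omega_n: all full binary trees with n leaves (height <= n - 1, so fuel n
   suffices), each exactly once. *)
Definition Omega (n : nat) : list tree := trees_fuel n n.

Fixpoint hs_order (t : tree) : nat :=
  match t with
  | Leaf => 1
  | Node a b =>
      let ra := hs_order a in
      let rb := hs_order b in
      if Nat.eqb ra rb then S ra else Nat.max ra rb
  end%nat.

(* A branch of order r is a maximal connected path of nodes of order r.
   Since a node has at most one child of its own order, each branch is a
   descending chain, identified by its top node: a node of order r that is
   the root or whose parent has order different from r.
   tops_below r t counts such top nodes strictly below the root of t. *)
Fixpoint tops_below (r : nat) (t : tree) : nat :=
  match t with
  | Leaf => 0
  | Node a b =>
      let o := hs_order t in
      ((if Nat.eqb (hs_order a) r && negb (Nat.eqb o r) then 1 else 0)
       + (if Nat.eqb (hs_order b) r && negb (Nat.eqb o r) then 1 else 0)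
       + tops_below r a + tops_below r b)
  end%nat.

Definition branches (r : nat) (t : tree) : nat :=
  ((if Nat.eqb (hs_order t) r then 1 else 0) + tops_below r t)%nat.

Definition prob_le (n : nat) (X : tree -> R) (x : R) : R :=
  INR (length (filter (fun t => if Rle_dec (X t) x then true else false) (Omega n)))
  / INR (length (Omega n)).

Definition normal_density (mu s2 : R) (t : R) : R :=
  / sqrt (2 * PI * s2) * exp (- (t - mu) ^ 2 / (2 * s2)).

Definition normal_cdf (mu s2 x : R) : R :=
  RInt_gen (normal_density mu s2) (Rbar_locally m_infty) (at_point x).

(* Convergence in distribution of X_n (on (Omega_n, P_n)) to N(mu, s2):
   CDFs converge at every x (the limit CDF is continuous everywhere). *)
Definition conv_dist_normal (X : nat -> tree -> R) (mu s2 : R) : Prop :=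
  forall x : R, is_lim_seq (fun n => prob_le n (X n) x) (normal_cdf mu s2 x).

(* Main.v *)
(* Let [S_r] be the number of branches of order [r].  Pruning a tree (deleting its
   leaves and contracting the chains that appear) lowers every order by one, and
   the number of trees with [n] leaves that prune to a given tree depends only on
   the number [m] of its leaves.  Hence, for uniform trees with [n] leaves,
   [S_1 = n, S_2, S_3, ...] is a Markov chain whose kernel is the law of the number
   of cherries [S_2] of a uniform tree.  The explicit fibre sizes give two
   identities for this kernel: a ratio recursion, which is a discrete Stein
   identity, and the growth step of Rémy's algorithm, which controls how the law
   depends on [m].  Composing them along the chain shows that [S = S_(r+1)] satisfies
   [E[(S - n / 4^r) f(S)] = sigma_r^2 n E[f(S + 1) - f(S)] + O(|f| + sqrt n |Df|)] with
   [sigma_(r+1)^2 = 1 / (16 4^r) + sigma_r^2 / 16].  Stein's equation for a continuous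
   approximation of the indicator of a half-line then yields the convergence of
   the distribution functions. *)
Require Import Defs.
From Stdlib Require Import Bool Reals Lra Lia List Arith.
From Coquelicot Require Import Coquelicot.
Import ListNotations.
Open Scope R_scope.

(** * Finite sums *)

(** The limit has to be carried through [r] steps of a kernel whose starting state is itself random.
    A Stein identity composes well: write [S - n / 4^(r+1) = (S - M / 4) + (M - n / 4^r) / 4], with
    [M] the preceding branch number. The first summand is treated by the identity of the kernel, the
    second by the identity for [M], applied to [g(m) = E[f(S) | M = m]]. The latter produces the
    difference of [g], about which the Stein identity of the kernel says nothing. The growth step
    fills this gap: it expresses [Dg(m)] as a conditional mean of [Df] with weight
    [(m - 2 k) / (2 m - 1)], close to [1 / 4]. The two factors [1 / 4] make the [1 / 16] of the
    variance recursion. All errors are controlled by mean absolute deviations of order [sqrt n]. At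
    the end the test function is a solution of Stein's equation at scale [sqrt n]: its differences
    are [O(1 / sqrt n)], so the error stays bounded while the identity is divided by [sqrt n]. *)

Definition lsum {A : Type} (F : A -> R) (l : list A) : R :=
  fold_right (fun x s => F x + s) 0 l.

Lemma lsum_app {A : Type} (F : A -> R) (l l' : list A) :
  lsum F (l ++ l') = lsum F l + lsum F l'.
Proof. induction l as [|x l IH]; simpl; [|rewrite IH]; ring. Qed.

Lemma lsum_ext {A : Type} (F G : A -> R) (l : list A) :
  (forall x, In x l -> F x = G x) -> lsum F l = lsum G l.
Proof.
  induction l as [|x l IH]; simpl; intros H; [easy|].
  rewrite (H x), IH; auto.
Qed.

Lemma lsum_plus {A : Type} (F G : A -> R) (l : list A) :
  lsum (fun x => F x + G x) l = lsum F l + lsum G l.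
Proof. induction l as [|x l IH]; simpl; [|rewrite IH]; ring. Qed.

Lemma lsum_scal {A : Type} (c : R) (F : A -> R) (l : list A) :
  lsum (fun x => c * F x) l = c * lsum F l.
Proof. induction l as [|x l IH]; simpl; [|rewrite IH]; ring. Qed.

Lemma lsum_0 {A : Type} (F : A -> R) (l : list A) :
  (forall x, In x l -> F x = 0) -> lsum F l = 0.
Proof.
  intros H. rewrite (lsum_ext F (fun x => 0 * 0)) by (intros; rewrite H; auto; ring).
  rewrite lsum_scal. ring.
Qed.

Lemma lsum_le {A : Type} (F G : A -> R) (l : list A) :
  (forall x, In x l -> F x <= G x) -> lsum F l <= lsum G l.
Proof.
  induction l as [|x l IH]; simpl; intros H; [lra|].
  apply Rplus_le_compat; auto.
Qed.

Lemma lsum_swap {A B : Type} (F : A -> B -> R) (l : list A) (l' : list B) :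
  lsum (fun x => lsum (F x) l') l = lsum (fun y => lsum (fun x => F x y) l) l'.
Proof.
  induction l as [|x l IH]; simpl.
  - symmetry; apply lsum_0; auto.
  - rewrite IH, lsum_plus. reflexivity.
Qed.

Lemma lsum_map {A B : Type} (F : B -> R) (g : A -> B) (l : list A) :
  lsum F (map g l) = lsum (fun x => F (g x)) l.
Proof. induction l as [|x l IH]; simpl; [|rewrite IH]; reflexivity. Qed.

Lemma lsum_flat_map {A B : Type} (F : B -> R) (g : A -> list B) (l : list A) :
  lsum F (flat_map g l) = lsum (fun x => lsum F (g x)) l.
Proof.
  induction l as [|x l IH]; simpl; [easy|]. rewrite lsum_app, IH. reflexivity.
Qed.

Lemma lsum_one {A : Type} (l : list A) : lsum (fun _ => 1) l = INR (length l).
Proof.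
  induction l as [|x l IH]; simpl lsum; [easy|]. rewrite IH. simpl length.
  rewrite S_INR. ring.
Qed.

Lemma lsum_filter {A : Type} (b : A -> bool) (l : list A) :
  INR (length (filter b l)) = lsum (fun x => if b x then 1 else 0) l.
Proof.
  induction l as [|x l IH]; simpl; [easy|].
  destruct (b x); simpl length; rewrite ?S_INR, IH; ring.
Qed.

Definition nsum (a : nat -> R) (n : nat) : R := lsum a (seq 0 n).

Lemma nsum_S (a : nat -> R) (n : nat) : nsum a (S n) = nsum a n + a n.
Proof. unfold nsum. rewrite seq_S, lsum_app. simpl. ring. Qed.

Lemma nsum_S_l (a : nat -> R) (n : nat) :
  nsum a (S n) = a 0%nat + nsum (fun k => a (S k)) n.
Proof. unfold nsum. simpl. rewrite <- seq_shift, lsum_map. reflexivity. Qed.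

Lemma nsum_ext (a b : nat -> R) (n : nat) :
  (forall k, (k < n)%nat -> a k = b k) -> nsum a n = nsum b n.
Proof. intros H. apply lsum_ext. intros k Hk. apply in_seq in Hk. apply H. lia. Qed.

Lemma nsum_le (a b : nat -> R) (n : nat) :
  (forall k, (k < n)%nat -> a k <= b k) -> nsum a n <= nsum b n.
Proof. intros H. apply lsum_le. intros k Hk. apply in_seq in Hk. apply H. lia. Qed.

Lemma nsum_extend (a : nat -> R) (n m : nat) :
  (n <= m)%nat -> (forall k, (n <= k)%nat -> a k = 0) -> nsum a m = nsum a n.
Proof.
  intros Hnm H. induction Hnm as [|m Hnm IH]; [easy|].
  rewrite nsum_S, IH, H by auto. ring.
Qed.

Lemma nsum_swap (F : nat -> nat -> R) (n m : nat) :
  nsum (fun k => nsum (F k) m) n = nsum (fun i => nsum (fun k => F k i) n) m.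
Proof. apply lsum_swap. Qed.

(** Regroups pairs [(i, j)] by their sum; in [tsum_prune] it collects pairs of subtrees by the
    number of leaves of the tree they form. *)
Lemma nsum_triangle (a : nat -> nat -> R) (n : nat) :
  nsum (fun m => nsum (fun i => a i (m - i)%nat) (S m)) n
  = nsum (fun i => nsum (fun j => a i j) (n - i)) n.
Proof.
  induction n as [|n IH]; [easy|].
  rewrite nsum_S, IH, (nsum_S (fun i => nsum (fun j => a i j) (S n - i))).
  replace (S n - n)%nat with 1%nat by lia.
  rewrite nsum_S, Nat.sub_diag, <- Rplus_assoc.
  f_equal.
  - unfold nsum at 1 3 4. rewrite <- lsum_plus. apply lsum_ext. intros i Hi. apply in_seq in Hi.
    rewrite Nat.sub_succ_l, nsum_S by lia. reflexivity.
  - unfold nsum. simpl. ring.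
Qed.

(** * Coefficient sequences of power series *)

Definition conv (a b : nat -> R) (n : nat) : R :=
  nsum (fun k => a k * b (n - k)%nat) (S n).

(** The coefficients of [x^p] times the series of [a]. *)
Fixpoint shift (p : nat) (a : nat -> R) (k : nat) : R :=
  match p, k with
  | O, _ => a k
  | S _, O => 0
  | S p, S k => shift p a k
  end.

Lemma shift_lt (p : nat) (a : nat -> R) (k : nat) : (k < p)%nat -> shift p a k = 0.
Proof. revert k; induction p as [|p IH]; intros [|k] H; simpl; try lia; auto. apply IH; lia. Qed.

Lemma shift_add (p : nat) (a : nat -> R) (k : nat) : shift p a (p + k) = a k.
Proof. induction p as [|p IH]; simpl; auto. Qed.

Lemma conv_shift_l (p : nat) (a b : nat -> R) (n : nat) :
  conv (shift p a) b n = shift p (conv a b) n.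
Proof.
  revert n; induction p as [|p IH]; intros n; [easy|].
  unfold conv at 1. rewrite nsum_S_l. destruct n as [|n]; simpl shift.
  - unfold nsum; simpl. ring.
  - rewrite <- IH. unfold conv. rewrite Rmult_0_l, Rplus_0_l. apply nsum_ext. easy.
Qed.

Lemma conv_shift_r (p : nat) (a b : nat -> R) (n : nat) :
  conv a (shift p b) n = shift p (conv a b) n.
Proof.
  revert n; induction p as [|p IH]; intros n; [easy|].
  unfold conv at 1. rewrite nsum_S, Nat.sub_diag. simpl shift at 2.
  destruct n as [|n]; simpl shift at 2.
  - unfold nsum; simpl. ring.
  - rewrite <- IH. unfold conv. rewrite Rmult_0_r, Rplus_0_r. apply nsum_ext.
    intros k Hk. rewrite Nat.sub_succ_l by lia. reflexivity.
Qed.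

Lemma shift_ext (p : nat) (a b : nat -> R) (n : nat) :
  (forall k, a k = b k) -> shift p a n = shift p b n.
Proof. intros H; revert n; induction p as [|p IH]; intros [|n]; simpl; auto. Qed.

Lemma shift_shift (p q : nat) (a : nat -> R) (n : nat) :
  shift p (shift q a) n = shift (p + q) a n.
Proof. revert n; induction p as [|p IH]; intros [|n]; simpl; auto. Qed.

(* [geom_coef e j] is the coefficient of [x^j] in [(1 - 2 x)^(-e)]. *)
Fixpoint geom_coef (e : nat) : nat -> R :=
  match e with
  | O => fun j => match j with O => 1 | S _ => 0 end
  | S e' => fix we (j : nat) : R :=
      match j with O => 1 | S j' => 2 * we j' + geom_coef e' (S j') end
  end.

Lemma geom_coef_0 (e : nat) : geom_coef e 0 = 1.
Proof. destruct e; easy. Qed.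

Lemma geom_coef_SS (e j : nat) : geom_coef (S e) (S j) = 2 * geom_coef (S e) j + geom_coef e (S j).
Proof. easy. Qed.

Lemma geom_coef_pos (e j : nat) : 0 <= geom_coef e j.
Proof.
  revert j; induction e as [|e IHe]; intros j.
  - destruct j; simpl; lra.
  - induction j as [|j IHj]; [rewrite geom_coef_0; lra|]. rewrite geom_coef_SS.
    specialize (IHe (S j)). lra.
Qed.

(** With [G_e = (1 - 2 x)^(-e)] this is [G_e G_f = G_(e+f)], by induction on [e] and on the degree
    through [G_(e+1) = 2 x G_(e+1) + G_e]. *)
Lemma conv_geom_coef (e f n : nat) : conv (geom_coef e) (geom_coef f) n = geom_coef (e + f) n.
Proof.
  revert n; induction e as [|e IHe]; intros n.
  - unfold conv. rewrite nsum_S_l, Nat.sub_0_r. unfold nsum.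
    rewrite lsum_0 by (intros; simpl; ring).
    simpl. ring.
  - induction n as [|n IHn].
    + unfold conv, nsum. cbn [seq lsum fold_right Nat.sub]. rewrite !geom_coef_0. ring.
    + cbn [Nat.add]. rewrite geom_coef_SS, <- IHe. change (S (e + f)) with (S e + f)%nat.
      rewrite <- IHn.
      unfold conv. rewrite nsum_S_l, (nsum_S_l (fun k => geom_coef e k * _)), !geom_coef_0.
      rewrite <- Rplus_assoc, (Rplus_comm (2 * _)), Rplus_assoc. f_equal.
      unfold nsum. rewrite <- lsum_scal, <- lsum_plus. apply lsum_ext. intros k _.
      rewrite geom_coef_SS. cbn [Nat.sub]. ring.
Qed.

(** Later identities between fibre sizes reduce to the ratios in [j] (here) and in [e]
    ([geom_coef_step_e]) of [geom_coef e j], which is [2^j binom(e + j - 1, j)]. *)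
Lemma geom_coef_step_j (e j : nat) :
  (INR j + 1) * geom_coef e (S j) = 2 * (INR j + INR e) * geom_coef e j.
Proof.
  revert j; induction e as [|e IHe]; intros j.
  - destruct j; simpl INR; simpl geom_coef; ring.
  - induction j as [|j IHj].
    + rewrite geom_coef_SS, !geom_coef_0. specialize (IHe 0%nat). rewrite geom_coef_0 in IHe.
      rewrite S_INR. simpl INR in *. lra.
    + specialize (IHe (S j)). rewrite (geom_coef_SS _ (S j)). rewrite Rmult_plus_distr_l, IHe.
      replace (geom_coef e (S j)) with (geom_coef (S e) (S j) - 2 * geom_coef (S e) j)
    by (rewrite geom_coef_SS; ring).
      rewrite !S_INR in *. nra.
Qed.

Lemma geom_coef_step_e (e j : nat) : INR e * geom_coef (S e) j = (INR j + INR e) * geom_coef e j.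
Proof.
  destruct j as [|j]; [rewrite !geom_coef_0; simpl; ring|].
  replace (geom_coef e (S j)) with (geom_coef (S e) (S j) - 2 * geom_coef (S e) j)
    by (rewrite geom_coef_SS; ring).
  generalize (geom_coef_step_j (S e) j). rewrite !S_INR. nra.
Qed.

(** * Pruning *)

Definition tsum (n : nat) (F : tree -> R) : R := lsum F (Omega n).

Lemma tsum_ext (n : nat) (F G : tree -> R) :
  (forall t, In t (Omega n) -> F t = G t) -> tsum n F = tsum n G.
Proof. apply lsum_ext. Qed.

Lemma trees_fuel_enough (f n : nat) : (n <= f)%nat -> trees_fuel f n = Omega n.
Proof.
  revert n. induction f as [f IH] using (well_founded_induction lt_wf). intros n Hn.
  destruct f as [|f]; [replace n with 0%nat by lia; easy|].
  destruct n as [|n]; [easy|]. unfold Omega. cbn [trees_fuel].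
  destruct (Nat.eqb_spec (S n) 1) as [_|Hn1]; [easy|].
  rewrite 2 flat_map_concat_map. f_equal. apply map_ext_in. intros k Hk. apply in_seq in Hk.
  rewrite !(IH f), !(IH n) by lia.
  easy.
Qed.

Lemma Omega_1 : Omega 1 = [Leaf].
Proof. easy. Qed.

Lemma Omega_node (n : nat) : (2 <= n)%nat ->
  Omega n = flat_map (fun k => flat_map (fun a => map (fun b => Node a b) (Omega (n - k)))
                                        (Omega k)) (seq 1 (n - 1)).
Proof.
  intros Hn. destruct n as [|n]; [lia|]. unfold Omega at 1. cbn [trees_fuel].
  destruct (Nat.eqb_spec (S n) 1) as [H|_]; [lia|].
  rewrite 2 flat_map_concat_map. f_equal. apply map_ext_in. intros k Hk. apply in_seq in Hk.
  rewrite !trees_fuel_enough by lia. easy.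
Qed.

Lemma tsum_1 (F : tree -> R) : tsum 1 F = F Leaf.
Proof. unfold tsum. rewrite Omega_1. simpl. ring. Qed.

(** The range of [k] is wider than in [Omega_node]: as [Omega 0] is empty the extreme terms vanish,
    and the sum is a full convolution. *)
Lemma tsum_node (n : nat) (F : tree -> R) : (2 <= n)%nat ->
  tsum n F = nsum (fun k => tsum k (fun a => tsum (n - k) (fun b => F (Node a b)))) (S n).
Proof.
  intros Hn. rewrite nsum_S_l. rewrite (eq_refl : tsum 0 _ = 0), Rplus_0_l.
  destruct n as [|n]; [lia|]. rewrite nsum_S.
  replace (tsum (S n) (fun a => tsum (S n - S n) _)) with 0
    by (rewrite Nat.sub_diag; symmetry; apply lsum_0; easy).
  rewrite Rplus_0_r. unfold tsum at 1. rewrite Omega_node by easy. rewrite lsum_flat_map.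
  unfold nsum. cbn [Nat.sub]. rewrite Nat.sub_0_r, <- seq_shift, lsum_map.
  apply lsum_ext. intros k _. rewrite lsum_flat_map. apply lsum_ext. intros a _.
  rewrite lsum_map. easy.
Qed.

Lemma Omega_leaves (n : nat) (t : tree) : In t (Omega n) -> leaves t = n.
Proof.
  revert t. induction n as [n IH] using (well_founded_induction lt_wf). intros t Ht.
  destruct n as [|[|n]]; [easy| |].
  - destruct Ht as [<-|[]]. easy.
  - rewrite Omega_node in Ht by lia. apply in_flat_map in Ht. destruct Ht as [k [Hk Ht]].
    apply in_seq in Hk.
    apply in_flat_map in Ht. destruct Ht as [a [Ha Ht]].
    apply in_map_iff in Ht. destruct Ht as [b [<- Hb]]. simpl.
    apply IH in Ha; [|lia]. apply IH in Hb; lia.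
Qed.

(* Removing all leaves and contracting the nodes that then have a single
   child; [prune Leaf] is a junk value. *)
Fixpoint prune (t : tree) : tree :=
  match t with
  | Leaf => Leaf
  | Node a b =>
      match a, b with
      | Leaf, Leaf => Leaf
      | Leaf, _ => prune b
      | _, Leaf => prune a
      | _, _ => Node (prune a) (prune b)
      end
  end.

(** * Orders and branches under pruning *)

Lemma hs_order_pos (t : tree) : (1 <= hs_order t)%nat.
Proof.
  induction t as [|a IHa b IHb]; simpl; [lia|].
  destruct (Nat.eqb_spec (hs_order a) (hs_order b)); lia.
Qed.

Lemma hs_order_node (a b : tree) : (2 <= hs_order (Node a b))%nat.
Proof.
  simpl. pose proof (hs_order_pos a). pose proof (hs_order_pos b).
  destruct (Nat.eqb_spec (hs_order a) (hs_order b)); lia.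
Qed.

(** Only leaves have order 1. The inner statement is about internal nodes because a tree reduced to
    a leaf has its top at the root, which [tops_below] does not count. *)
Lemma branches_1 (t : tree) : branches 1 t = leaves t.
Proof.
  unfold branches.
  assert (H : forall a b, tops_below 1 (Node a b) = leaves (Node a b)).
  { intros a b. generalize (hs_order_node a b). remember (Node a b) as t' eqn:E.
    revert a b E. induction t' as [|x IHx y IHy]; intros a b E Ho; [easy|].
    cbn [tops_below leaves].
    destruct (Nat.eqb_spec (hs_order (Node x y)) 1) as [E1|_]; [lia|].
    assert (K : forall z, (forall a b, z = Node a b -> (2 <= hs_order z)%nat ->
                     tops_below 1 z = leaves z) ->
                 ((if (hs_order z =? 1)%nat && negb false then 1 else 0)
                  + tops_below 1 z)%nat = leaves z).
    { intros [|u v] Hz; [easy|]. pose proof (hs_order_node u v) as Huv.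
      rewrite (Hz u v) by easy. destruct (Nat.eqb_spec (hs_order (Node u v)) 1); [lia|easy]. }
    specialize (K x IHx) as Kx. specialize (K y IHy) as Ky. lia. }
  destruct t as [|a b]; [easy|]. rewrite H. pose proof (hs_order_node a b).
  destruct (Nat.eqb_spec (hs_order (Node a b)) 1); [lia|easy].
Qed.

(** By cases on which children are leaves. Beside a single leaf child, the parent has the order of
    its other child, so contracting it neither creates nor destroys a top of order at least 2. If no
    child is a leaf, both orders drop by one and their comparison at the root is unchanged. *)
Lemma prune_spec (t : tree) : t <> Leaf ->
  hs_order t = S (hs_order (prune t)) /\
  forall r, (1 <= r)%nat -> tops_below (S r) t = tops_below r (prune t).
Proof.
  induction t as [|a IHa b IHb]; intros Ht; [easy|].
  destruct (match a with Leaf => true | _ => false end) eqn:Ea;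
  destruct (match b with Leaf => true | _ => false end) eqn:Eb.
  - destruct a; [|easy]. destruct b; [|easy]. split; [easy|].
    intros [|r] Hr; [lia|]. easy.
  - destruct a; [|easy]. destruct IHb as [Ho Htop]; [intros ->; easy|].
    replace (prune (Node Leaf b)) with (prune b) by (destruct b; easy).
    pose proof (hs_order_pos (prune b)).
    assert (E : hs_order (Node Leaf b) = hs_order b).
    { cbn [hs_order]. rewrite Ho. destruct (Nat.eqb_spec 1 (S (hs_order (prune b)))); lia. }
    split; [lia|]. intros r Hr. cbn [tops_below]. rewrite E, Htop by easy.
    cbn [hs_order]. destruct (Nat.eqb_spec 1 (S r)); [lia|].
    destruct (Nat.eqb_spec (hs_order b) (S r)); easy.
  - destruct b; [|easy]. destruct IHa as [Ho Htop]; [intros ->; easy|].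
    replace (prune (Node a Leaf)) with (prune a) by (destruct a; easy).
    pose proof (hs_order_pos (prune a)).
    assert (E : hs_order (Node a Leaf) = hs_order a).
    { cbn [hs_order]. rewrite Ho. destruct (Nat.eqb_spec (S (hs_order (prune a))) 1); lia. }
    split; [lia|]. intros r Hr. cbn [tops_below]. rewrite E, Htop by easy.
    cbn [hs_order]. destruct (Nat.eqb_spec 1 (S r)); [lia|].
    destruct (Nat.eqb_spec (hs_order a) (S r)); simpl; lia.
  - destruct IHa as [Hoa Hta]; [intros ->; easy|].
    destruct IHb as [Hob Htb]; [intros ->; easy|].
    replace (prune (Node a b)) with (Node (prune a) (prune b)) by (destruct a, b; easy).
    assert (E : hs_order (Node a b) = S (hs_order (Node (prune a) (prune b)))).
    { cbn [hs_order]. rewrite Hoa, Hob. cbn [Nat.eqb].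
      destruct (Nat.eqb_spec (hs_order (prune a)) (hs_order (prune b))); lia. }
    split; [easy|]. intros r Hr. cbn [tops_below]. rewrite E, Hoa, Hob, Hta, Htb by easy.
    easy.
Qed.

Lemma branches_prune (r : nat) (t : tree) : (1 <= r)%nat -> (2 <= leaves t)%nat ->
  branches (S r) t = branches r (prune t).
Proof.
  intros Hr Ht. destruct (prune_spec t) as [Ho Htop]; [intros ->; simpl in Ht; lia|].
  unfold branches. rewrite Ho, Htop by easy. easy.
Qed.

(** * Counting the trees that prune to a given tree *)

(* [fibre n m] counts the trees with [n] leaves pruning to a given tree with
   [m] leaves: each of its [2 m - 1] nodes carries a chain of left or right
   leaves, and these chains share the [n - 2 m] remaining leaves. *)
Definition fibre (n m : nat) : R :=
  match m with O => 0 | S _ => shift (2 * m) (geom_coef (2 * m - 1)) n end.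

Lemma fibre_lt (n m : nat) : (n < 2 * m)%nat -> fibre n m = 0.
Proof. intros H. destruct m; [easy|]. apply shift_lt. easy. Qed.

Lemma fibre_add (m j : nat) : (1 <= m)%nat -> fibre (2 * m + j) m = geom_coef (2 * m - 1) j.
Proof. intros H. destruct m; [lia|]. apply shift_add. Qed.

Lemma fibre_pos (n m : nat) : 0 <= fibre n m.
Proof.
  destruct m as [|m]; [simpl; lra|].
  destruct (le_lt_dec (2 * S m) n) as [H|H].
  - replace n with (2 * S m + (n - 2 * S m))%nat by lia. rewrite fibre_add by lia.
    apply geom_coef_pos.
  - rewrite fibre_lt by lia. lra.
Qed.

(** The exponents [2 i - 1] and [2 j - 1] add up to one less than [2 (i + j) - 1]: when two subtrees
    are joined, the chain above the new root is still missing. [fibre_rec] supplies it as a further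
    factor [1 / (1 - 2 x)]. *)
Lemma fibre_conv (n i j : nat) : (1 <= i)%nat -> (1 <= j)%nat ->
  conv (fun k => fibre k i) (fun k => fibre k j) n
  = shift (2 * (i + j)) (geom_coef (2 * (i + j) - 2)) n.
Proof.
  intros Hi Hj. destruct i as [|i]; [lia|]. destruct j as [|j]; [lia|]. unfold fibre.
  rewrite (conv_shift_l (2 * S i) (geom_coef (2 * S i - 1))
             (shift (2 * S j) (geom_coef (2 * S j - 1)))).
  rewrite (shift_ext _ _ (shift (2 * S j) (conv (geom_coef (2 * S i - 1))
                                            (geom_coef (2 * S j - 1)))))
    by (intros; apply conv_shift_r).
  rewrite shift_shift, <- Nat.mul_add_distr_l.
  rewrite (shift_ext _ _ _ _ (conv_geom_coef _ _)). f_equal. f_equal. lia.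
Qed.

Lemma fibre_rec (n m : nat) : (2 <= m)%nat ->
  fibre (S n) m = 2 * fibre n m + shift (2 * m) (geom_coef (2 * m - 2)) (S n).
Proof.
  intros Hm. destruct (le_lt_dec (2 * m) n) as [H|H].
  - replace n with (2 * m + (n - 2 * m))%nat by lia.
    set (j := (n - 2 * m)%nat). replace (S (2 * m + j)) with (2 * m + S j)%nat by lia.
    rewrite !fibre_add, shift_add by lia.
    replace (2 * m - 1)%nat with (S (2 * m - 2)) by lia. apply geom_coef_SS.
  - destruct (Nat.eq_dec (S n) (2 * m)) as [E|E].
    + rewrite (fibre_lt n) by lia. replace (S n) with (2 * m + 0)%nat by lia.
      rewrite fibre_add, shift_add, !geom_coef_0 by lia. ring.
    + rewrite !fibre_lt, shift_lt by lia. ring.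
Qed.

(** For [m = 1] the pruned tree is a leaf and not a join of two subtrees, so the recursion has no
    second term: [fibre n 1 = 2^(n-2)] for [n >= 2]. *)
Lemma fibre_1 (j : nat) : fibre (S (S (S j))) 1 = 2 * fibre (S (S j)) 1.
Proof. simpl. destruct j; simpl; ring. Qed.

Lemma tsum_const (n : nat) (c : R) : tsum n (fun _ => c) = c * INR (length (Omega n)).
Proof.
  unfold tsum. rewrite <- lsum_one, <- lsum_scal. apply lsum_ext. intros; ring.
Qed.

(** The value 0 at sizes 0 and 1 keeps the junk value [prune Leaf] out of the sums. *)
Definition tsum_nodes (n : nat) (F : tree -> R) : R :=
  match n with S (S _) => tsum n (fun t => F (prune t)) | _ => 0 end.

Lemma Omega_Node_ex (n : nat) (t : tree) : In t (Omega (S (S n))) -> exists a b, t = Node a b.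
Proof. intros H. apply Omega_leaves in H. destruct t as [|a b]; [easy|]. eauto. Qed.

Lemma nsum_split_ends (f : nat -> R) (n : nat) :
  nsum f (S (S (S (S n))))
  = f 0%nat + f 1%nat + nsum (fun k => f (S (S k))) n + f (S (S n)) + f (S (S (S n))).
Proof. rewrite 2 (nsum_S f), 2 nsum_S_l. ring. Qed.

(** Either one child of the root is a leaf, on one of two sides, and pruning contracts the root; or
    neither is, and pruning keeps it. With at least three leaves the children are not both
    leaves. *)
Lemma tsum_prune_node (n : nat) (F : tree -> R) : (3 <= n)%nat ->
  tsum n (fun t => F (prune t))
  = 2 * tsum (n - 1) (fun t => F (prune t))
    + nsum (fun k => tsum_nodes k (fun x => tsum_nodes (n - k) (fun y => F (Node x y)))) (S n).
Proof.
  intros Hn. rewrite tsum_node by lia.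
  destruct n as [|[|[|n]]]; try lia.
  rewrite 2 nsum_split_ends, !Nat.sub_diag.
  replace (S (S (S n)) - S (S n))%nat with 1%nat by lia.
  cbn [tsum_nodes]. rewrite !tsum_1. rewrite (eq_refl : tsum 0 _ = 0), !tsum_const.
  rewrite (tsum_ext (S (S (S n))) _ (fun _ => 0)), tsum_const by easy.
  replace (S (S (S n)) - 1)%nat with (S (S n)) by lia.
  rewrite (tsum_ext (S (S n)) (fun b => F (prune (Node Leaf b))) (fun t => F (prune t)))
    by (intros t Ht; destruct (Omega_Node_ex _ _ Ht) as [a [b ->]]; easy).
  rewrite (tsum_ext (S (S n)) (fun a => tsum 1 _) (fun t => F (prune t)))
    by (intros t Ht; destruct (Omega_Node_ex _ _ Ht) as [a [b ->]]; rewrite tsum_1; easy).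
  rewrite (nsum_ext _ (fun k => tsum (S (S k)) (fun a => tsum_nodes (S (S (S n)) - S (S k))
             (fun y => F (Node (prune a) y))))); [ring|].
  intros k Hk. replace (S (S (S n)) - S (S k))%nat with (S (S (n - 1 - k)))%nat by lia.
  cbn [tsum_nodes]. apply tsum_ext. intros a Ha. apply tsum_ext. intros b Hb.
  destruct (Omega_Node_ex _ _ Ha) as [a1 [a2 ->]].
  destruct (Omega_Node_ex _ _ Hb) as [b1 [b2 ->]]. easy.
Qed.

(** Both sides satisfy the recursion of [tsum_prune_node], the right one by [fibre_conv] and
    [fibre_rec]. [F] is general because the induction hypothesis is applied to
    [fun y => F (Node x y)]; [N] is a common upper limit for the sums at all smaller sizes. *)
Lemma tsum_prune (n N : nat) (F : tree -> R) : (2 <= n <= N)%nat ->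
  tsum n (fun t => F (prune t)) = nsum (fun m => fibre n m * tsum m F) N.
Proof.
  intros [Hn HN]. revert F.
  induction n as [n IH] using (well_founded_induction lt_wf). intros F.
  destruct (Nat.eq_dec n 2) as [->|Hn2].
  { rewrite (nsum_extend _ 2 N); [|easy|intros k Hk; rewrite fibre_lt by lia; ring].
    unfold tsum, Omega, nsum. simpl. ring. }
  rewrite tsum_prune_node by lia. rewrite IH by lia.
  assert (IHn : forall k G, (k < n)%nat ->
            tsum_nodes k G = nsum (fun m => fibre k m * tsum m G) N).
  { intros k G Hk. destruct k as [|[|k]].
    1, 2: cbn [tsum_nodes]; symmetry; apply lsum_0; intros [|m] _; [simpl; ring|];
          rewrite fibre_lt by lia; ring.
    apply IH; lia. }
  set (T := fun i j => tsum i (fun x => tsum j (fun y => F (Node x y)))).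
  set (d := fun m => shift (2 * m) (geom_coef (2 * m - 2)) n).
  assert (E : forall k, (k < S n)%nat ->
    tsum_nodes k (fun x => tsum_nodes (n - k) (fun y => F (Node x y)))
    = nsum (fun i => nsum (fun j => fibre k i * fibre (n - k) j * T i j) N) N).
  { intros k Hk. destruct (Nat.eq_dec k 0) as [->|Hk0].
    { symmetry; apply lsum_0; intros [|i] _; apply lsum_0; intros j _; [simpl; ring|].
      rewrite (fibre_lt 0) by lia. ring. }
    (* Size [n] is out of reach of the induction hypothesis, but the other factor then has size 0
       and both sides vanish. *)
    destruct (Nat.eq_dec k n) as [->|Hkn].
    { rewrite Nat.sub_diag. cbn [tsum_nodes]. destruct n as [|[|n]]; try lia.
      cbn [tsum_nodes]. rewrite tsum_const.
      transitivity 0; [ring|].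
      symmetry; apply lsum_0; intros i _; apply lsum_0; intros [|j] _; [simpl; ring|].
      rewrite (fibre_lt 0) by lia. ring. }
    rewrite IHn by lia. apply nsum_ext. intros i _.
    unfold T, nsum.
    rewrite (tsum_ext i _ (fun x => nsum (fun j => fibre (n - k) j
                 * tsum j (fun y => F (Node x y))) N)) by (intros; apply IHn; lia).
    unfold tsum at 1, nsum at 1. rewrite lsum_swap, <- lsum_scal.
    apply lsum_ext. intros j _. rewrite lsum_scal. unfold tsum. ring. }
  rewrite (nsum_ext _ _ _ E).
  rewrite (nsum_swap (fun k i => nsum (fun j => fibre k i * fibre (n - k) j * T i j) N)).
  rewrite (nsum_ext (fun i => nsum (fun k => nsum _ N) (S n))
             (fun i => nsum (fun j => d (i + j)%nat * T i j) (N - i)) N).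
  (* Summing over [k] first gives the convolution of two fibre sequences. It vanishes for
     [i + j >= N], where [n < 2 (i + j)], which leaves a triangle. *)
  2:{ intros i _. cbv beta. rewrite (nsum_swap (fun k j => fibre k i * fibre (n - k) j * T i j)).
      rewrite <- (nsum_extend _ (N - i) N); [|lia|].
      - apply lsum_ext. intros j _. unfold nsum.
        destruct i as [|i]; [rewrite (eq_refl : T 0%nat j = 0), lsum_0 by (intros; ring); ring|].
        destruct j as [|j].
        { assert (H0 : T (S i) 0%nat = 0) by (apply lsum_0; easy).
          rewrite H0, lsum_0 by (intros; ring). ring. }
        unfold d. rewrite <- fibre_conv by lia. unfold conv, nsum.
        rewrite (Rmult_comm (lsum _ _)), <- lsum_scal. apply lsum_ext. intros; ring.
      - intros j Hj. unfold d. rewrite shift_lt by lia. ring. }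
  rewrite <- (nsum_triangle (fun i j => d (i + j)%nat * T i j)).
  unfold nsum at 1 2 4. rewrite <- lsum_scal, <- lsum_plus. apply lsum_ext. intros m _.
  rewrite (nsum_ext _ (fun i => d m * T i (m - i)%nat)) by (intros; do 2 f_equal; lia).
  unfold nsum. rewrite lsum_scal.
  destruct m as [|[|m]].
  - simpl. rewrite (eq_refl : T 0%nat 0%nat = 0). ring.
  - simpl seq. simpl lsum. rewrite (eq_refl : T 0%nat _ = 0).
    assert (H0 : T 1%nat 0%nat = 0) by (apply lsum_0; easy). rewrite H0.
    destruct n as [|[|[|n]]]; try lia. rewrite fibre_1.
    replace (S (S (S n)) - 1)%nat with (S (S n)) by lia. ring.
  - rewrite (tsum_node (S (S m)) F) by lia.
    change (lsum (fun i => T i (S (S m) - i)%nat) (seq 0 (S (S (S m)))))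
      with (nsum (fun k => tsum k (fun a => tsum (S (S m) - k) (fun b => F (Node a b))))
                 (S (S (S m)))).
    destruct n as [|n]; [lia|]. rewrite fibre_rec by lia. unfold d.
    replace (S n - 1)%nat with n by lia. ring.
Qed.

(** * The law of the number of cherries *)

Definition num_trees (n : nat) : R := INR (length (Omega n)).

Lemma num_trees_tsum (n : nat) : num_trees n = tsum n (fun _ => 1).
Proof. rewrite tsum_const. unfold num_trees. ring. Qed.

(** Cherries are the leaves of the pruned tree, so [fibre n k * num_trees k] counts the trees with
    [n] leaves and [k] cherries. *)
Lemma tsum_branches_2 (n N : nat) (f : nat -> R) : (2 <= n <= N)%nat ->
  tsum n (fun t => f (branches 2 t)) = nsum (fun k => fibre n k * num_trees k * f k) N.
Proof.
  intros H. rewrite <- (tsum_ext n (fun t => (fun x => f (leaves x)) (prune t))).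
  - rewrite (tsum_prune n N (fun x => f (leaves x))) by easy. apply nsum_ext. intros k _.
    rewrite (tsum_ext k _ (fun _ => f k)) by (intros t Ht; rewrite (Omega_leaves _ _ Ht); easy).
    rewrite tsum_const. unfold num_trees. ring.
  - intros t Ht. apply Omega_leaves in Ht. rewrite branches_prune, branches_1 by lia. easy.
Qed.

(** The ratio of consecutive Catalan numbers. It is a predicate because it enters [fibre_step_n] as
    a hypothesis at a smaller index; [catalan] then closes the loop by strong induction. *)
Definition catalan_step (n : nat) : Prop :=
  (INR n + 1) * num_trees (S n) = 2 * (2 * INR n - 1) * num_trees n.

(** Counting form of growth by one leaf: in a tree with [n] leaves and [k] cherries, grafting at
    [n - 1 + 2 k] nodes keeps [k] and at [n - 2 k] nodes raises it; the factor 2 is the side, and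
    [n + 1] the choice of the added leaf. The proof is algebraic: each term is a rational multiple
    of one product [geom_coef e j * num_trees (S k)]. *)
Lemma fibre_step_n (n k : nat) : (1 <= k)%nat ->
  (k = 1%nat \/ (n + 1 < 2 * k)%nat \/ catalan_step (k - 1)) ->
  (2 <= n)%nat ->
  (INR n + 1) * (fibre (S n) k * num_trees k)
  = 2 * ((INR n - 1 + 2 * INR k) * (fibre n k * num_trees k)
         + (INR n - 2 * INR k + 2) * (fibre n (k - 1) * num_trees (k - 1))).
Proof.
  intros Hk Hc Hn.
  destruct k as [|[|k]]; [lia| |].
  { destruct n as [|[|n]]; [lia..|]. rewrite fibre_1. simpl (1 - 1)%nat. simpl (fibre _ 0).
    simpl (INR 1). ring. }
  replace (S (S k) - 1)%nat with (S k) in * by lia.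
  destruct (le_lt_dec (2 * S (S k)) (n + 1)) as [Hl|Hl].
  - destruct Hc as [Hc|[Hc|Hc]]; [lia..|].
    remember (n + 1 - 2 * S (S k))%nat as j eqn:Hj.
    assert (En : INR n = INR j + 2 * INR k + 3).
    { replace n with (j + 2 * k + 3)%nat by lia.
      rewrite !plus_INR, mult_INR. simpl INR. ring. }
    unfold catalan_step in Hc. rewrite !S_INR in *.
    replace (S n) with (2 * S (S k) + j)%nat by lia. rewrite fibre_add by lia.
    replace (fibre n (S k)) with (geom_coef (2 * S k - 1) (S j))
      by (rewrite <- fibre_add by lia; f_equal; lia).
    replace (2 * S (S k) - 1)%nat with (S (S (2 * k + 1))) by lia.
    replace (2 * S k - 1)%nat with (2 * k + 1)%nat by lia.
    set (e := (2 * k + 1)%nat).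
    assert (Ee : INR e = 2 * INR k + 1) by (unfold e; rewrite plus_INR, mult_INR; simpl INR; ring).
    pose proof (geom_coef_step_e (S e) j) as W1. pose proof (geom_coef_step_e e j) as W2.
    pose proof (geom_coef_step_j e j) as W3. rewrite !S_INR in W1.
    pose proof (pos_INR k) as Pk. pose proof (pos_INR j) as Pj.
    (* [fibre n (S (S k))] is 0 when [j = 0]; writing it as a match lets one identity cover both
       cases. *)
    assert (W4 : 2 * (INR j + INR e + 1) * match j with O => 0 | S j' => geom_coef (S (S e)) j' end
                 = INR j * geom_coef (S (S e)) j).
    { destruct j as [|j']; [simpl; ring|].
      pose proof (geom_coef_step_j (S (S e)) j') as W. rewrite !S_INR in *. lra. }
    replace (fibre n (S (S k))) with (match j with O => 0 | S j' => geom_coef (S (S e)) j' end).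
    2:{ destruct j as [|j']; [rewrite fibre_lt by lia; easy|].
        replace n with (2 * S (S k) + j')%nat by lia. rewrite fibre_add by lia. f_equal. lia. }
    rewrite En.
    set (y := match j with O => 0 | S j' => geom_coef (S (S e)) j' end) in *.
    set (x := geom_coef (S (S e)) j) in *.
    set (u := geom_coef e (S j)) in *. set (v := geom_coef e j) in *.
    set (s := geom_coef (S e) j) in *.
    set (z1 := num_trees (S (S k))) in *. set (z0 := num_trees (S k)) in *.
    rewrite Ee in *. set (K := INR k) in *. set (J := INR j) in *.
    assert (Hu : u = 2 * (J + (2 * K + 1)) * v / (J + 1)) by (field_simplify_eq; lra).
    assert (Hs : s = (J + (2 * K + 1)) * v / (2 * K + 1)) by (field_simplify_eq; lra).
    assert (Hx : x = (J + (2 * K + 1 + 1)) * s / (2 * K + 1 + 1)) by (field_simplify_eq; lra).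
    assert (Hy : y = J * x / (2 * (J + (2 * K + 1) + 1))) by (field_simplify_eq; lra).
    assert (Hz : z1 = 2 * (2 * (K + 1) - 1) * z0 / (K + 1 + 1)) by (field_simplify_eq; lra).
    rewrite Hy, Hx, Hs, Hu, Hz. field. lra.
  - rewrite !(fibre_lt _ (S (S k))) by lia.
    destruct (Nat.eq_dec n (2 * S k)) as [->|E].
    + rewrite mult_INR. rewrite (S_INR (S k)). simpl (INR 2). ring.
    + rewrite fibre_lt by lia. ring.
Qed.

Lemma tsum_branches_2_step (n N : nat) (f : nat -> R) : (2 <= n < N)%nat ->
  (forall k, (1 <= k)%nat -> (2 * k <= n)%nat -> catalan_step k) ->
  (INR n + 1) * nsum (fun k => fibre (S n) k * num_trees k * f k) N
  = 2 * nsum (fun k => fibre n k * num_trees k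
          * ((INR n - 1 + 2 * INR k) * f k + (INR n - 2 * INR k) * f (S k))) N.
Proof.
  intros [Hn HN] Hc.
  rewrite (nsum_ext (fun k => fibre n k * num_trees k * _)
    (fun k => fibre n k * num_trees k * (INR n - 1 + 2 * INR k) * f k
     + fibre n k * num_trees k * (INR n - 2 * INR k) * f (S k))) by (intros; ring).
  unfold nsum at 2. rewrite lsum_plus.
  fold (nsum (fun k => fibre n k * num_trees k * (INR n - 1 + 2 * INR k) * f k) N).
  fold (nsum (fun k => fibre n k * num_trees k * (INR n - 2 * INR k) * f (S k)) N).
  destruct N as [|N]; [lia|].
  rewrite (nsum_S_l (fun k => fibre (S n) k * num_trees k * f k)), (nsum_S_l (fun k => _ * f k)).
  rewrite (nsum_S (fun k => fibre n k * num_trees k * (INR n - 2 * INR k) * f (S k))).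
  rewrite (fibre_lt n N) by lia. simpl (fibre _ 0).
  rewrite Rmult_0_l, Rmult_0_l, Rplus_0_l, !Rmult_0_l, Rplus_0_l, Rplus_0_r.
  unfold nsum. rewrite <- lsum_plus, <- !lsum_scal. apply lsum_ext. intros k _.
  assert (H : k = 0%nat \/ (n < 2 * k)%nat \/ catalan_step k).
  { destruct (Nat.eq_dec k 0); [auto|]. destruct (le_lt_dec (2 * k) n); [|auto].
    right; right. apply Hc; lia. }
  pose proof (fibre_step_n n (S k) ltac:(lia)) as HS. cbn [Nat.sub] in HS.
  rewrite Nat.sub_0_r in HS.
  transitivity ((INR n + 1) * (fibre (S n) (S k) * num_trees (S k)) * f (S k)); [ring|].
  rewrite HS; [rewrite S_INR; ring| |easy].
  destruct H as [->|[H|H]]; [now left| |now right; right]. right; left. lia.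
Qed.

Lemma num_trees_1 : num_trees 1 = 1.
Proof. easy. Qed.

(** For [f = 1] the weights [n - 1 + 2 k] and [n - 2 k] add up to [2 n - 1], whatever [k] is. The
    recursion asks for the Catalan ratio at [2 k <= n] only, hence at [k < n]. *)
Lemma catalan (n : nat) : (1 <= n)%nat -> catalan_step n.
Proof.
  induction n as [n IH] using (well_founded_induction lt_wf). intros Hn.
  destruct (Nat.eq_dec n 1) as [->|Hn1].
  { unfold catalan_step, num_trees. simpl. ring. }
  unfold catalan_step.
  rewrite (num_trees_tsum (S n)), (num_trees_tsum n).
  rewrite (tsum_branches_2 (S n) (S n) (fun _ => 1)), (tsum_branches_2 n (S n) (fun _ => 1)) by lia.
  rewrite tsum_branches_2_step by (try lia; intros; apply IH; lia).
  unfold nsum. rewrite <- !lsum_scal. apply lsum_ext. intros k _. ring.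
Qed.

Lemma num_trees_pos (n : nat) : (1 <= n)%nat -> 0 < num_trees n.
Proof.
  intros Hn. induction Hn as [|n Hn IH]; [rewrite num_trees_1; lra|].
  pose proof (catalan n Hn) as H. unfold catalan_step in H.
  apply le_INR in Hn. simpl in Hn. nra.
Qed.

(* The transition operator of the chain [S_1, S_2, ...]; the state [0], reached
   when the order exceeds that of the root, is absorbing. *)
Definition cherry_op (f : nat -> R) (m : nat) : R :=
  match m with O => f O | S _ => tsum m (fun t => f (branches 2 t)) / num_trees m end.

Lemma cherry_op_1 (f : nat -> R) : cherry_op f 1 = f 0%nat.
Proof. unfold cherry_op. rewrite tsum_1, num_trees_1. unfold branches; simpl. field. Qed.

Lemma cherry_op_sum (m N : nat) (f : nat -> R) : (2 <= m <= N)%nat ->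
  cherry_op f m = nsum (fun k => fibre m k * num_trees k * f k) N / num_trees m.
Proof.
  intros H. rewrite <- tsum_branches_2 by easy. destruct m; [lia|]. easy.
Qed.

(** One pruning is the first step of the chain. A single leaf is treated apart, its pruning being a
    junk value: there the chain enters the absorbing state 0. *)
Lemma tsum_branches (r n : nat) (f : nat -> R) : (1 <= n)%nat ->
  tsum n (fun t => f (branches (S r) t)) = num_trees n * Nat.iter r cherry_op f n.
Proof.
  revert n; induction r as [|r IH]; intros n Hn; simpl Nat.iter.
  { rewrite (tsum_ext n _ (fun _ => f n)).
    - rewrite tsum_const. unfold num_trees. ring.
    - intros t Ht. apply Omega_leaves in Ht. rewrite branches_1, Ht. easy. }
  destruct (Nat.eq_dec n 1) as [->|Hn1].
  { rewrite tsum_1, cherry_op_1, num_trees_1, Rmult_1_l.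
    replace (branches (S (S r)) Leaf) with 0%nat by (destruct r; easy).
    clear IH. induction r as [|r IH]; easy. }
  rewrite (tsum_ext n _ (fun t => (fun x => f (branches (S r) x)) (prune t))).
  2:{ intros t Ht. apply Omega_leaves in Ht. rewrite branches_prune by lia. easy. }
  rewrite (tsum_prune n n (fun x => f (branches (S r) x))), (cherry_op_sum n n) by lia.
  rewrite Rmult_div_assoc. rewrite Rmult_div_r.
  2:{ pose proof (num_trees_pos n Hn); lra. }
  apply nsum_ext. intros [|k] _; [simpl; ring|]. rewrite IH by lia. ring.
Qed.

Lemma cherry_op_linear (a : R) (f g : nat -> R) (m : nat) :
  cherry_op (fun k => a * f k + g k) m = a * cherry_op f m + cherry_op g m.
Proof.
  destruct m as [|m]; [easy|]. unfold cherry_op, tsum. rewrite lsum_plus, lsum_scal.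
  unfold Rdiv. ring.
Qed.

Lemma cherry_op_one (m : nat) : cherry_op (fun _ => 1) m = 1.
Proof.
  destruct m as [|m]; [easy|]. unfold cherry_op. rewrite <- num_trees_tsum. field.
  pose proof (num_trees_pos (S m) ltac:(lia)). lra.
Qed.

(** The restriction [2 k <= m], valid as each cherry uses two leaves, later keeps ratios such as
    [(m - 2 k) / (2 m - 1)] in the unit interval. *)
Lemma cherry_op_le (f g : nat -> R) (m : nat) :
  (forall k, (2 * k <= m)%nat -> f k <= g k) -> cherry_op f m <= cherry_op g m.
Proof.
  intros H. destruct m as [|[|m]]; [apply H; lia|rewrite !cherry_op_1; apply H; lia|].
  rewrite !(cherry_op_sum _ (S (S m))) by lia.
  apply Rmult_le_compat_r; [apply Rlt_le, Rinv_0_lt_compat, num_trees_pos; lia|].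
  apply nsum_le. intros k _.
  destruct (le_lt_dec (2 * k) (S (S m))) as [Hk|Hk]; [|rewrite fibre_lt by lia; lra].
  apply Rmult_le_compat_l; [|auto].
  apply Rmult_le_pos; [apply fibre_pos|apply pos_INR].
Qed.

Lemma cherry_op_ext (f g : nat -> R) (m : nat) :
  (forall k, (2 * k <= m)%nat -> f k = g k) -> cherry_op f m = cherry_op g m.
Proof. intros H. apply Rle_antisym; apply cherry_op_le; intros k Hk; rewrite H; lra || auto. Qed.

(** * The Stein identity and the growth identity of the kernel *)

Lemma fibre_step_k (n k : nat) : (1 <= k)%nat ->
  4 * INR k * (INR k + 1) * (fibre n (S k) * num_trees (S k))
  = (INR n - 2 * INR k) * (INR n - 2 * INR k - 1) * (fibre n k * num_trees k).
Proof.
  intros Hk. pose proof (catalan k Hk) as Hc. unfold catalan_step in Hc.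
  destruct (le_lt_dec (2 * S k) n) as [Hl|Hl].
  - remember (n - 2 * S k)%nat as j eqn:Hj.
    assert (En : INR n = INR j + 2 * INR k + 2).
    { replace n with (j + 2 * k + 2)%nat by lia. rewrite !plus_INR, mult_INR. simpl INR. ring. }
    replace (fibre n (S k)) with (geom_coef (2 * S k - 1) j)
      by (rewrite <- fibre_add by lia; f_equal; lia).
    replace (fibre n k) with (geom_coef (2 * k - 1) (S (S j)))
      by (rewrite <- fibre_add by lia; f_equal; lia).
    replace (2 * S k - 1)%nat with (S (S (2 * k - 1))) by lia.
    set (e := (2 * k - 1)%nat).
    assert (Ee : INR e = 2 * INR k - 1)
      by (unfold e; rewrite minus_INR, mult_INR by lia; simpl INR; ring).
    pose proof (geom_coef_step_e (S e) j) as W1. pose proof (geom_coef_step_e e j) as W2.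
    pose proof (geom_coef_step_j e j) as W3. pose proof (geom_coef_step_j e (S j)) as W4.
    rewrite !S_INR in *. rewrite En.
    pose proof (pos_INR j) as Pj. apply le_INR in Hk. simpl in Hk.
    rewrite Ee in *. set (K := INR k) in *. set (J := INR j) in *.
    set (a := geom_coef (S (S e)) j) in *.
    set (b := geom_coef (S e) j) in *. set (c := geom_coef e j) in *.
    set (d := geom_coef e (S (S j))) in *. set (g := geom_coef e (S j)) in *.
    assert (Hb : b = (J + (2 * K - 1)) * c / (2 * K - 1)) by (field_simplify_eq; lra).
    assert (Ha : a = (J + (2 * K - 1 + 1)) * b / (2 * K)) by (field_simplify_eq; lra).
    assert (Hg : g = 2 * (J + (2 * K - 1)) * c / (J + 1)) by (field_simplify_eq; lra).
    assert (Hd : d = 2 * (J + 1 + (2 * K - 1)) * g / (J + 1 + 1)) by (field_simplify_eq; lra).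
    assert (Hz : num_trees (S k) = 2 * (2 * K - 1) * num_trees k / (K + 1))
      by (field_simplify_eq; lra).
    rewrite Hz, Ha, Hb, Hd, Hg. field. lra.
  - rewrite (fibre_lt n (S k)) by lia.
    destruct (Nat.eq_dec n (2 * k)) as [->|E]; [rewrite mult_INR; simpl (INR 2); ring|].
    destruct (Nat.eq_dec n (2 * k + 1)) as [->|E'];
      [rewrite plus_INR, mult_INR; simpl (INR 2); simpl (INR 1); ring|].
    rewrite fibre_lt by lia. ring.
Qed.

Definition fdiff (f : nat -> R) (k : nat) : R := f (S k) - f k.

(** Multiplying [fibre_step_k] by [f (S k)] and shifting the index gives [E[4 k (k - 1) f(k)] =
    E[(m - 2 k) (m - 2 k - 1) f(k + 1)]]. The squares of [k] cancel in the difference of the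
    coefficients, which is [- 4 m (k - m / 4) + 6 k - m]; this singles out the centre [m / 4]. *)
Lemma cherry_op_stein (m : nat) (f : nat -> R) :
  4 * INR m * cherry_op (fun k => (INR k - INR m / 4) * f k) m
  = cherry_op (fun k => (INR m - 2 * INR k) * (INR m - 2 * INR k - 1) * fdiff f k) m
    + cherry_op (fun k => (6 * INR k - INR m) * f k) m.
Proof.
  destruct m as [|[|m]].
  - simpl. unfold fdiff. ring.
  - rewrite !cherry_op_1. simpl. field.
  - set (n := S (S m)).
    rewrite !(cherry_op_sum n (S n)) by (unfold n; lia).
    unfold Rdiv. rewrite <- Rmult_plus_distr_r, <- Rmult_assoc. f_equal.
    set (a := fun k => fibre n k * num_trees k).
    assert (E : nsum (fun k => a k * (4 * INR k * (INR k - 1)) * f k) (S n)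
              = nsum (fun k => a k * ((INR n - 2 * INR k) * (INR n - 2 * INR k - 1)) * f (S k)) (S n)).
    { rewrite nsum_S_l, nsum_S. unfold a at 1 4. simpl (fibre n 0).
      rewrite (fibre_lt n n) by (unfold n; lia).
      rewrite !Rmult_0_l, Rplus_0_l, Rplus_0_r. apply nsum_ext. intros [|k] _.
      - unfold a. simpl. ring.
      - rewrite (S_INR (S k)). unfold a. rewrite <- (Rmult_comm _ (fibre n (S k) * _)).
        rewrite <- fibre_step_k by lia. ring. }
    unfold nsum in *. rewrite <- lsum_scal, <- lsum_plus.
    apply (Rplus_eq_reg_l (lsum (fun k => a k * (4 * INR k * (INR k - 1)) * f k) (seq 0 (S n)))).
    rewrite E at 1. rewrite <- !lsum_plus. apply lsum_ext. intros k _.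
    unfold fdiff, a. field.
Qed.

(* The growth step of Rémy's algorithm: a new leaf creates a cherry exactly when
   it is grafted on one of the [m - 2 k] leaves outside the [k] cherries,
   among the [2 m - 1] nodes. *)
Lemma cherry_op_growth (m : nat) (f : nat -> R) :
  fdiff (cherry_op f) m
  = cherry_op (fun k => (INR m - 2 * INR k) / (2 * INR m - 1) * fdiff f k) m.
Proof.
  unfold fdiff at 1. destruct m as [|[|m]].
  - rewrite cherry_op_1. simpl. unfold fdiff. field.
  - rewrite !cherry_op_1. rewrite (cherry_op_sum 2 2) by lia.
    unfold nsum, fdiff, num_trees, fibre. simpl. field.
  - set (n := S (S m)). pose proof (catalan n ltac:(lia)) as Hc. unfold catalan_step in Hc.
    pose proof (num_trees_pos n ltac:(lia)) as P0.
    pose proof (num_trees_pos (S n) ltac:(lia)) as P1.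
    rewrite (cherry_op_sum (S n) (S n)), !(cherry_op_sum n (S n)) by (unfold n; lia).
    pose proof (tsum_branches_2_step n (S n) f ltac:(unfold n; lia)
      ltac:(intros; apply catalan; lia)) as H.
    assert (Pn : 2 <= INR n) by (apply (le_INR 2); unfold n; lia).
    assert (E : nsum (fun k => fibre (S n) k * num_trees k * f k) (S n) / num_trees (S n)
       = nsum (fun k => fibre n k * num_trees k
          * ((INR n - 1 + 2 * INR k) * f k + (INR n - 2 * INR k) * f (S k))) (S n)
         / ((2 * INR n - 1) * num_trees n)).
    { revert H. generalize (nsum (fun k => fibre (S n) k * num_trees k * f k) (S n)) as A.
      match goal with |- context [2 * nsum ?b (S n)] => generalize (nsum b (S n)) as B end.
      intros B A H.
      replace A with (2 * B / (INR n + 1)) by (field_simplify_eq; lra).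
      replace (num_trees (S n)) with (2 * (2 * INR n - 1) * num_trees n / (INR n + 1))
        by (field_simplify_eq; lra).
      field. lra. }
    rewrite E. unfold nsum. unfold Rdiv.
    rewrite !(Rmult_comm (lsum _ _)), <- !lsum_scal.
    apply (Rplus_eq_reg_r (lsum (fun k => / num_trees n * (fibre n k * num_trees k * f k)) (seq 0 (S n)))).
    unfold Rminus. rewrite Rplus_assoc, Rplus_opp_l, Rplus_0_r, <- lsum_plus.
    apply lsum_ext. intros k _. unfold fdiff. field. lra.
Qed.

(** * The Markov chain of branch numbers *)

(* The expectation of [f (branches (S r) t)] for uniform [t] in [Omega n]. *)
Definition law (r n : nat) (f : nat -> R) : R := Nat.iter r cherry_op f n.

(** Conditions on the last step, where unfolding [Nat.iter] conditions on the first: the kernel acts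
    on the test function, as the inductions on [r] below require. *)
Lemma law_S (r n : nat) (f : nat -> R) : law (S r) n f = law r n (fun m => law 1 m f).
Proof. unfold law. rewrite Nat.iter_succ_r. reflexivity. Qed.

Lemma law_le (r n : nat) (f g : nat -> R) :
  (forall k, (k <= n)%nat -> f k <= g k) -> law r n f <= law r n g.
Proof.
  unfold law. revert n; induction r as [|r IH]; intros n H; simpl; [apply H; lia|].
  apply cherry_op_le. intros k Hk. apply IH. intros j Hj. apply H. lia.
Qed.

Lemma law_ext (r n : nat) (f g : nat -> R) :
  (forall k, (k <= n)%nat -> f k = g k) -> law r n f = law r n g.
Proof. intros H. apply Rle_antisym; apply law_le; intros k Hk; rewrite H; lra || easy. Qed.

Lemma law_linear (r n : nat) (a : R) (f g : nat -> R) :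
  law r n (fun k => a * f k + g k) = a * law r n f + law r n g.
Proof.
  revert n; induction r as [|r IH]; intros n; [easy|].
  unfold law in *. simpl. rewrite <- cherry_op_linear. apply cherry_op_ext. auto.
Qed.

Lemma law_one (r n : nat) : law r n (fun _ => 1) = 1.
Proof.
  revert n; induction r as [|r IH]; intros n; [easy|].
  unfold law in *. simpl. transitivity (cherry_op (fun _ => 1) n); [|apply cherry_op_one].
  apply cherry_op_ext. auto.
Qed.

Lemma law_const (r n : nat) (c : R) : law r n (fun _ => c) = c.
Proof.
  rewrite (law_ext r n _ (fun k => (c - 1) * 1 + 1)) by (intros; ring).
  rewrite law_linear, law_one. ring.
Qed.

Lemma law_plus (r n : nat) (f g : nat -> R) :
  law r n (fun k => f k + g k) = law r n f + law r n g.
Proof.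
  rewrite (law_ext r n _ (fun k => 1 * f k + g k)) by (intros; ring).
  rewrite law_linear. ring.
Qed.

Lemma law_scal (r n : nat) (a : R) (f : nat -> R) :
  law r n (fun k => a * f k) = a * law r n f.
Proof.
  rewrite (law_ext r n _ (fun k => a * f k + 0)) by (intros; ring).
  rewrite law_linear, law_const. ring.
Qed.

Lemma law_minus (r n : nat) (f g : nat -> R) :
  law r n (fun k => f k - g k) = law r n f - law r n g.
Proof.
  rewrite (law_ext r n _ (fun k => -1 * g k + f k)) by (intros; ring).
  rewrite law_linear. ring.
Qed.

Lemma law_bound (r n : nat) (f g : nat -> R) :
  (forall k, (k <= n)%nat -> Rabs (f k) <= g k) -> Rabs (law r n f) <= law r n g.
Proof.
  intros H. apply Rabs_le. split.
  - replace (- law r n g) with (law r n (fun k => -1 * g k)) by (rewrite law_scal; ring).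
    apply law_le. intros k Hk. specialize (H k Hk). apply Rabs_le_between in H. lra.
  - apply law_le. intros k Hk. specialize (H k Hk). apply Rabs_le_between in H. lra.
Qed.

Lemma law_1_bound (m : nat) (f g : nat -> R) :
  (forall k, (2 * k <= m)%nat -> Rabs (f k) <= g k) -> Rabs (law 1 m f) <= law 1 m g.
Proof.
  intros H. apply Rabs_le. split.
  - replace (- law 1 m g) with (law 1 m (fun k => -1 * g k)) by (rewrite law_scal; ring).
    apply cherry_op_le. intros k Hk. specialize (H k Hk). apply Rabs_le_between in H. lra.
  - apply cherry_op_le. intros k Hk. specialize (H k Hk). apply Rabs_le_between in H. lra.
Qed.

Lemma law_1_le (m : nat) (f g : nat -> R) :
  (forall k, (2 * k <= m)%nat -> f k <= g k) -> law 1 m f <= law 1 m g.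
Proof. apply cherry_op_le. Qed.

(** * Mean deviations of the branch numbers *)

(** The Stein identity with [f] the centred variable itself, its right-hand side bounded crudely by
    [4 m^2]. *)
Lemma law_1_variance (m : nat) : law 1 m (fun k => (INR k - INR m / 4) ^ 2) <= INR m.
Proof.
  destruct m as [|m]; [unfold law; simpl; lra|]. set (n := S m).
  assert (Hn : 1 <= INR n) by (apply (le_INR 1); unfold n; lia).
  pose proof (cherry_op_stein n (fun k => INR k - INR n / 4)) as H.
  change (cherry_op ?f n) with (law 1 n f) in H.
  rewrite <- law_plus in H.
  rewrite (law_ext 1 n _ (fun k => (INR k - INR n / 4) ^ 2)) in H by (intros; ring).
  assert (B : law 1 n (fun k => (INR n - 2 * INR k) * (INR n - 2 * INR k - 1) *
            fdiff (fun k0 => INR k0 - INR n / 4) k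
            + (6 * INR k - INR n) * (INR k - INR n / 4)) <= 4 * INR n * INR n).
  { rewrite <- (law_const 1 n (4 * INR n * INR n)). apply law_1_le. intros k Hk.
    apply le_INR in Hk. rewrite mult_INR in Hk. simpl (INR 2) in Hk.
    pose proof (pos_INR k). unfold fdiff. rewrite S_INR.
    assert (0 <= INR k * (INR n - 2 * INR k)) by (apply Rmult_le_pos; lra).
    nra. }
  rewrite <- H in B. apply (Rmult_le_reg_l (4 * INR n)); lra.
Qed.

Lemma law_1_deviation (m : nat) :
  law 1 m (fun k => Rabs (INR k - INR m / 4)) <= sqrt (INR m).
Proof.
  destruct m as [|m].
  { unfold law; simpl. replace (0 - 0 / 4) with 0 by field. rewrite Rabs_R0. apply sqrt_pos. }
  set (n := S m).
  assert (Hn : 1 <= INR n) by (apply (le_INR 1); unfold n; lia).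
  set (s := sqrt (INR n)).
  assert (Hs : 0 < s) by (apply sqrt_lt_R0; lra).
  assert (Hss : s * s = INR n) by (apply sqrt_sqrt; lra).
  (* [|v| <= v^2 / (2 s) + s / 2] plays the part of the Cauchy-Schwarz inequality. *)
  apply Rle_trans with (law 1 n (fun k => / (2 * s) * (INR k - INR n / 4) ^ 2 + s / 2)).
  - apply law_le. intros k _. apply (Rmult_le_reg_l (2 * s)); [lra|].
    rewrite <- pow2_abs. set (v := Rabs (INR k - INR n / 4)).
    rewrite Rmult_plus_distr_l, <- Rmult_assoc, Rinv_r by lra.
    pose proof (pow2_ge_0 (v - s)). nra.
  - rewrite law_plus, law_scal, law_const. pose proof (law_1_variance n) as V.
    apply (Rmult_le_compat_l (/ (2 * s))) in V; [|apply Rlt_le, Rinv_0_lt_compat; lra].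
    replace (/ (2 * s) * INR n) with (s / 2) in V by (rewrite <- Hss; field; lra). lra.
Qed.

(** A step adds at most [sqrt m <= sqrt n] and divides the earlier deviation by 4; the constant 2 is
    stable since [2 / 4 + 1 <= 2]. *)
Lemma law_deviation (r n : nat) :
  law r n (fun k => Rabs (INR k - INR n / 4 ^ r)) <= 2 * sqrt (INR n).
Proof.
  induction r as [|r IH].
  { unfold law; simpl. replace (INR n - INR n / 1) with 0 by field. rewrite Rabs_R0.
    pose proof (sqrt_pos (INR n)). lra. }
  rewrite law_S.
  apply Rle_trans with (law r n (fun m => / 4 * Rabs (INR m - INR n / 4 ^ r) + sqrt (INR n))).
  - apply law_le. intros m Hm.
    apply Rle_trans with (law 1 m (fun k => Rabs (INR k - INR m / 4)
                                       + / 4 * Rabs (INR m - INR n / 4 ^ r))).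
    + apply law_le. intros k _.
      replace (INR k - INR n / 4 ^ S r)
        with ((INR k - INR m / 4) + / 4 * (INR m - INR n / 4 ^ r))
        by (simpl; field; apply pow_nonzero; lra).
      eapply Rle_trans; [apply Rabs_triang|]. rewrite Rabs_mult, (Rabs_right (/ 4)) by lra. lra.
    + rewrite law_plus, law_const. pose proof (law_1_deviation m).
      apply le_INR in Hm. apply sqrt_le_1_alt in Hm. lra.
  - rewrite law_plus, law_scal, law_const. pose proof (sqrt_pos (INR n)). lra.
Qed.

Lemma law_1_stein_bound (m : nat) (f : nat -> R) (A B : R) :
  (forall k, Rabs (f k) <= A) -> (forall k, Rabs (fdiff f k) <= B) ->
  Rabs (law 1 m (fun k => (INR k - INR m / 4) * f k) - INR m / 16 * law 1 m (fdiff f))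
  <= A + B * (sqrt (INR m) + 1).
Proof.
  intros HA HB.
  assert (A0 : 0 <= A) by (eapply Rle_trans; [apply Rabs_pos|apply (HA 0%nat)]).
  assert (B0 : 0 <= B) by (eapply Rle_trans; [apply Rabs_pos|apply (HB 0%nat)]).
  destruct m as [|m].
  { unfold law; simpl. replace (_ - _) with 0 by field. rewrite Rabs_R0.
    rewrite sqrt_0. lra. }
  set (n := S m).
  assert (Hn : 1 <= INR n) by (apply (le_INR 1); unfold n; lia).
  pose proof (cherry_op_stein n f) as H. change (cherry_op ?f n) with (law 1 n f) in H.
  assert (E : law 1 n (fun k => (INR k - INR n / 4) * f k)
     = / (4 * INR n) * (law 1 n (fun k => (INR n - 2 * INR k) * (INR n - 2 * INR k - 1) * fdiff f k)
         + law 1 n (fun k => (6 * INR k - INR n) * f k))) by (rewrite <- H; field; lra).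
  rewrite E, <- law_plus, <- !law_scal, <- law_minus.
  eapply Rle_trans.
  - apply law_1_bound with (g := fun k => B * (Rabs (INR k - INR n / 4) + 1) + A).
    intros k Hk. apply le_INR in Hk. rewrite mult_INR in Hk. simpl (INR 2) in Hk.
    pose proof (pos_INR k) as Pk. set (u := INR k - INR n / 4).
    assert (Hu : Rabs u <= INR n / 4) by (apply Rabs_le; unfold u; lra).
    (* The coefficient of [fdiff f k], expanded at [u = k - n / 4], differs from [n / 16] by
       [- u / 2 + u^2 / n + u / (2 n) - 1 / 8]; as [|u| <= n / 4], this is at most [|u| + 1]. *)
    replace (/ (4 * INR n) * _ - _)
      with (((2 * u - 2 * INR n * u) / (4 * INR n) + u / INR n * u - / 8) * fdiff f k
            + (6 * INR k - INR n) / (4 * INR n) * f k)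
      by (unfold u; field; lra).
    eapply Rle_trans; [apply Rabs_triang|]. rewrite !Rabs_mult.
    apply Rplus_le_compat.
    + rewrite Rmult_comm. apply Rmult_le_compat; try apply Rabs_pos; [apply HB|].
      assert (Q : Rabs (u / INR n) <= / 4).
      { unfold Rdiv. rewrite Rabs_mult, (Rabs_right (/ INR n))
          by (apply Rle_ge, Rlt_le, Rinv_0_lt_compat; lra).
        apply (Rmult_le_reg_r (INR n)); [lra|].
        rewrite Rmult_assoc, Rinv_l by lra. lra. }
      replace ((2 * u - 2 * INR n * u) / (4 * INR n) + u / INR n * u - / 8)
        with (/ 2 * (u / INR n) + (- / 2 * u + (u / INR n * u + - / 8))) by (field; lra).
      pose proof (Rabs_triang (/ 2 * (u / INR n)) (- / 2 * u + (u / INR n * u + - / 8))).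
      pose proof (Rabs_triang (- / 2 * u) (u / INR n * u + - / 8)).
      pose proof (Rabs_triang (u / INR n * u) (- / 8)).
      rewrite !Rabs_mult, (Rabs_right (/ 2)), ?(Rabs_left (- / 2)) in * by lra.
      rewrite (Rabs_left (- / 8)) in * by lra.
      pose proof (Rabs_pos u).
      assert (Rabs (u / INR n) * Rabs u <= / 4 * Rabs u) by (apply Rmult_le_compat_r; lra).
      lra.
    + rewrite <- (Rmult_1_l A). apply Rmult_le_compat; try apply Rabs_pos; [|apply HA].
      unfold Rdiv. rewrite Rabs_mult, (Rabs_right (/ (4 * INR n)))
        by (apply Rle_ge, Rlt_le, Rinv_0_lt_compat; lra).
      apply (Rmult_le_reg_r (4 * INR n)); [lra|]. rewrite Rmult_assoc, Rinv_l by lra.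
      rewrite Rmult_1_r, Rmult_1_l. apply Rabs_le. lra.
  - rewrite law_plus, law_scal, law_plus, !law_const.
    pose proof (law_1_deviation n) as D.
    apply (Rmult_le_compat_l B) in D; [|easy]. fold n. lra.
Qed.

(** The weight [(m - 2 k) / (2 m - 1)] is near [1 / 4] because [k] is near [m / 4]. In the
    application [q = 4^r], so that [m] is near [n / q]. *)
Lemma law_1_growth_bound (q : R) (m n : nat) (f : nat -> R) (B : R) :
  1 <= q -> (m <= n)%nat -> (forall k, Rabs (fdiff f k) <= B) ->
  Rabs (INR n * fdiff (fun i => law 1 i f) m - INR n / 4 * law 1 m (fdiff f))
  <= B * q * (Rabs (INR m - INR n / q) + 2 * sqrt (INR n) + 1).
Proof.
  intros Hq Hmn HB.
  assert (B0 : 0 <= B) by (eapply Rle_trans; [apply Rabs_pos|apply (HB 0%nat)]).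
  change (fdiff (fun i => law 1 i f) m) with (fdiff (cherry_op f) m).
  rewrite cherry_op_growth. change (cherry_op ?f m) with (law 1 m f).
  rewrite <- !law_scal, <- law_minus.
  eapply Rle_trans.
  - apply law_1_bound with
      (g := fun k => B * (q * (Rabs (INR m - INR n / q)
                               + 2 * Rabs (INR k - INR m / 4) + 1))).
    intros k Hk. apply le_INR in Hk. rewrite mult_INR in Hk. simpl (INR 2) in Hk.
    pose proof (pos_INR k) as Pk.
    replace (INR n * ((INR m - 2 * INR k) / (2 * INR m - 1) * fdiff f k) - INR n / 4 * fdiff f k)
      with (fdiff f k * (INR n * ((INR m - 2 * INR k) / (2 * INR m - 1) - / 4)))
      by (unfold Rdiv; ring).
    rewrite Rabs_mult. apply Rmult_le_compat; try apply Rabs_pos; [apply HB|].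
    set (c := (INR m - 2 * INR k) / (2 * INR m - 1) - / 4).
    (* Since [n = q m - q (m - n / q)], the trivial bound [|c| <= 1] suffices against the deviation
       of [m], and only [m c] has to be estimated through that of [k]. *)
    replace (INR n * c) with (q * (- (INR m - INR n / q) * c + INR m * c)) by (field; lra).
    rewrite Rabs_mult, (Rabs_right q) by lra. apply Rmult_le_compat_l; [lra|].
    eapply Rle_trans; [apply Rabs_triang|]. rewrite Rabs_mult, Rabs_Ropp.
    assert (Hc : Rabs c <= 1 /\ Rabs (INR m * c) <= 2 * Rabs (INR k - INR m / 4) + 1).
    { destruct m as [|m].
      - simpl in *. unfold c. replace (INR k) with 0 by lra.
        replace ((0 - 2 * 0) / (2 * 0 - 1) - / 4) with (- / 4) by field.
        rewrite Rmult_0_l, Rabs_R0, (Rabs_left (- / 4)) by lra. split; [lra|].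
        pose proof (Rabs_pos (0 - 0 / 4)). lra.
      - set (M := INR (S m)) in *.
        assert (HM : 1 <= M) by (apply (le_INR 1); lia).
        assert (Hd : 0 <= (M - 2 * INR k) / (2 * M - 1) <= 1).
        { split; [apply Rdiv_le_0_compat; lra|].
          apply (Rmult_le_reg_r (2 * M - 1)); [lra|].
          unfold Rdiv. rewrite Rmult_assoc, Rinv_l by lra. lra. }
        split; [apply Rabs_le; unfold c; lra|].
        set (u := INR k - M / 4).
        replace (M * c) with (M / (2 * M - 1) * (/ 4 - 2 * u)) by (unfold c, u; field; lra).
        assert (Hr : 0 <= M / (2 * M - 1) <= 1).
        { split; [apply Rdiv_le_0_compat; lra|].
          apply (Rmult_le_reg_r (2 * M - 1)); [lra|].
          unfold Rdiv. rewrite Rmult_assoc, Rinv_l by lra. lra. }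
        rewrite Rabs_mult, (Rabs_right (M / _)) by lra.
        apply Rle_trans with (1 * Rabs (/ 4 - 2 * u));
          [apply Rmult_le_compat_r; [apply Rabs_pos|lra]|].
        rewrite Rmult_1_l. apply Rabs_le.
        pose proof (Rle_abs u). pose proof (Rle_abs (- u)) as X. rewrite Rabs_Ropp in X.
        lra. }
    destruct Hc as [Hc1 Hc2]. pose proof (Rabs_pos (INR m - INR n / q)).
    assert (Rabs (INR m - INR n / q) * Rabs c <= Rabs (INR m - INR n / q) * 1)
      by (apply Rmult_le_compat_l; lra).
    lra.
  - rewrite !law_scal, !law_plus, !law_scal, !law_const, <- Rmult_assoc.
    apply Rmult_le_compat_l; [apply Rmult_le_pos; lra|].
    pose proof (law_1_deviation m). apply le_INR, sqrt_le_1_alt in Hmn. lra.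
Qed.

(** * The variance recursion and the approximate Stein identity *)

Definition asym_var (r : nat) : R := / 3 * ((4 ^ r - 1) / 16 ^ r).

(** The law of total variance: the kernel contributes [m / 16] with [m] near [n / 4^r], and its
    mean, near [m / 4], multiplies the earlier variance by [1 / 16]. *)
Lemma asym_var_S (r : nat) : asym_var (S r) = / (16 * 4 ^ r) + asym_var r / 16.
Proof.
  unfold asym_var. simpl. replace (16 ^ r) with (4 ^ r * 4 ^ r)
    by (rewrite <- Rpow_mult_distr; f_equal; ring).
  field. apply pow_nonzero. lra.
Qed.

Lemma asym_var_bounds (r : nat) : 0 <= asym_var r <= 1.
Proof.
  induction r as [|r IH]; [unfold asym_var; simpl; lra|]. rewrite asym_var_S.
  pose proof (pow_R1_Rle 4 r ltac:(lra)).
  assert (0 < / (16 * 4 ^ r)) by (apply Rinv_0_lt_compat; lra).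
  assert (/ (16 * 4 ^ r) <= / 16) by (apply Rinv_le_contravar; lra). lra.
Qed.

Lemma asym_var_pos (r : nat) : (1 <= r)%nat -> 0 < asym_var r.
Proof.
  intros Hr. unfold asym_var. pose proof (Rlt_pow_R1 4 r ltac:(lra) ltac:(lia)).
  apply Rmult_lt_0_compat; [lra|]. apply Rdiv_lt_0_compat; [lra|apply pow_lt; lra].
Qed.

Lemma law_stein_bound (r : nat) : exists C, 0 <= C /\ forall (n : nat) (f : nat -> R) (A B : R),
  (forall k, Rabs (f k) <= A) -> (forall k, Rabs (fdiff f k) <= B) ->
  Rabs (law r n (fun k => (INR k - INR n / 4 ^ r) * f k)
        - asym_var r * INR n * law r n (fdiff f))
  <= C * (A + B * (sqrt (INR n) + 1)).
Proof.
  induction r as [|r [C [HC IH]]].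
  (* For [r = 0] the variable is the constant [n] and the variance is 0. *)
  { exists 0. split; [lra|]. intros n f A B _ _. unfold law, asym_var. simpl.
    replace (_ - _) with 0 by field. rewrite Rabs_R0. lra. }
  set (q := 4 ^ r) in *. assert (Hq : 1 <= q) by (apply pow_R1_Rle; lra).
  exists (2 + C + 2 * q). split; [lra|]. intros n f A B HA HB.
  assert (A0 : 0 <= A) by (eapply Rle_trans; [apply Rabs_pos|apply (HA 0%nat)]).
  assert (B0 : 0 <= B) by (eapply Rle_trans; [apply Rabs_pos|apply (HB 0%nat)]).
  rewrite asym_var_S, !(law_S r). fold q.
  pose proof (asym_var_bounds r) as Hs. set (s := asym_var r) in *.
  set (g := fun m => law 1 m f). set (e := fun m => law 1 m (fdiff f)).
  set (X := fun m => law 1 m (fun k => (INR k - INR m / 4) * f k)).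
  set (T := sqrt (INR n)). assert (HT : 0 <= T) by apply sqrt_pos.
  set (dev := fun m => Rabs (INR m - INR n / q)).
  assert (Hdev : law r n dev <= 2 * T) by apply law_deviation.
  assert (He : forall m, Rabs (e m) <= B).
  { intros m. unfold e. rewrite <- (law_const 1 m B). apply law_bound. auto. }
  assert (Hg : forall m, Rabs (g m) <= A).
  { intros m. unfold g. rewrite <- (law_const 1 m A). apply law_bound. auto. }
  (* The growth weight lies in the unit interval, so passing to the conditional expectation [g] does
     not enlarge the bound on differences. *)
  assert (Hdg : forall m, Rabs (fdiff g m) <= B).
  { intros m. change (fdiff g m) with (fdiff (cherry_op f) m). rewrite cherry_op_growth.
    change (cherry_op ?f m) with (law 1 m f). rewrite <- (law_const 1 m B).
    apply law_1_bound. intros k Hk. apply le_INR in Hk. rewrite mult_INR in Hk. simpl (INR 2) in Hk.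
    pose proof (pos_INR k). rewrite Rabs_mult, <- (Rmult_1_l B).
    apply Rmult_le_compat; try apply Rabs_pos; [|apply HB].
    destruct m as [|m].
    - simpl in *. replace (INR k) with 0 by lra.
      replace ((0 - 2 * 0) / (2 * 0 - 1)) with 0 by field. rewrite Rabs_R0. lra.
    - assert (HM : 1 <= INR (S m)) by (apply (le_INR 1); lia).
      apply Rabs_le. split.
      + apply Rle_trans with 0; [lra|]. apply Rdiv_le_0_compat; lra.
      + apply (Rmult_le_reg_r (2 * INR (S m) - 1)); [lra|].
        unfold Rdiv. rewrite Rmult_assoc, Rinv_l by lra. lra. }
  rewrite (law_ext r n _ (fun m => X m + / 4 * ((INR m - INR n / q) * g m))).
  2:{ intros m _. unfold X, g. rewrite <- !law_scal, <- law_plus. apply law_ext. intros k _.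
      simpl pow. fold q. field. lra. }
  rewrite law_plus, law_scal.
  specialize (IH n g A B Hg Hdg).
  (* The kernel yields the factor [m / 16]; replacing [m] by [n / q] costs [B / 16] times the
     deviation of [m], of mean at most [2 T]. *)
  assert (E1 : Rabs (law r n X - INR n / (16 * q) * law r n e)
               <= A + B * (T + 1) + B * T / 8).
  { rewrite <- law_scal, <- law_minus. eapply Rle_trans.
    - apply law_bound with (g := fun m => B / 16 * dev m + (A + B * (T + 1))).
      intros m Hm.
      replace (X m - INR n / (16 * q) * e m)
        with (/ 16 * ((INR m - INR n / q) * e m) + (X m - INR m / 16 * e m)) by (field; lra).
      eapply Rle_trans; [apply Rabs_triang|]. apply Rplus_le_compat.
      + rewrite !Rabs_mult, (Rabs_right (/ 16)) by lra.
        assert (dev m * Rabs (e m) <= dev m * B)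
          by (apply Rmult_le_compat_l; [apply Rabs_pos|apply He]).
        unfold dev in *. lra.
      + eapply Rle_trans; [apply (law_1_stein_bound m f A B HA HB)|].
        apply le_INR, sqrt_le_1_alt in Hm. fold T in Hm.
        apply Rplus_le_compat_l, Rmult_le_compat_l; lra.
    - rewrite law_plus, law_scal, law_const.
      apply (Rmult_le_compat_l (B / 16)) in Hdev; lra. }
  assert (E2 : Rabs (INR n * law r n (fdiff g) - INR n / 4 * law r n e)
               <= B * q * (4 * T + 1)).
  { rewrite <- !law_scal, <- law_minus. eapply Rle_trans.
    - apply law_bound with (g := fun m => B * q * (dev m + (2 * T + 1))).
      intros m Hm. eapply Rle_trans; [apply (law_1_growth_bound q m n f B); auto|].
      unfold dev, T. right; ring.
    - rewrite law_scal, law_plus, law_const. apply Rmult_le_compat_l; [|lra].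
      apply Rmult_le_pos; lra. }
  set (Y := law r n (fun m => (INR m - INR n / q) * g m)) in *.
  (* Three errors: the kernel identity, the induction hypothesis for [g], and the passage from
     [fdiff g] to [e]. The coefficients [n / (16 q)] and [(s / 4) (n / 4)] of [e] add up to the new
     variance times [n]. *)
  replace (law r n X + / 4 * Y - (/ (16 * q) + s / 16) * INR n * law r n e)
    with ((law r n X - INR n / (16 * q) * law r n e)
          + (/ 4 * (Y - s * INR n * law r n (fdiff g))
             + s / 4 * (INR n * law r n (fdiff g) - INR n / 4 * law r n e)))
    by (field; lra).
  eapply Rle_trans; [apply Rabs_triang|].
  eapply Rle_trans; [apply Rplus_le_compat_l, Rabs_triang|].
  rewrite (Rabs_mult (/ 4)), (Rabs_mult (s / 4)), (Rabs_right (/ 4)), (Rabs_right (s / 4)) by lra.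
  fold T in IH.
  assert (E3 : s / 4 * Rabs (INR n * law r n (fdiff g) - INR n / 4 * law r n e)
               <= / 4 * (B * q * (4 * T + 1))).
  { apply Rmult_le_compat; [lra|apply Rabs_pos|lra|easy]. }
  assert (0 <= B * T) by (apply Rmult_le_pos; lra).
  assert (0 <= q * B) by (apply Rmult_le_pos; lra).
  assert (0 <= q * (B * T)) by (apply Rmult_le_pos; lra).
  assert (0 <= C * B) by (apply Rmult_le_pos; lra).
  assert (0 <= C * (B * T)) by (apply Rmult_le_pos; lra).
  assert (0 <= q * A) by (apply Rmult_le_pos; lra).
  assert (0 <= C * A) by (apply Rmult_le_pos; lra).
  lra.
Qed.

(** * The Gaussian integral *)

Lemma ex_derive_continuity_pt (f : R -> R) (x : R) : ex_derive f x -> continuity_pt f x.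
Proof. intros H. apply derivable_continuous_pt, ex_derive_Reals_0, H. Qed.

Lemma is_derive_RInt_cont (g : R -> R) (a x : R) :
  (forall t, continuous g t) -> is_derive (RInt g a) x (g x).
Proof.
  intros Hg. apply (is_derive_RInt g (RInt g a) a x); [|apply Hg].
  apply filter_forall. intros y. apply (RInt_correct (V := R_CompleteNormedModule)),
    (ex_RInt_continuous (V := R_CompleteNormedModule)).
  intros; apply Hg.
Qed.

Definition gauss (l t : R) : R := exp (- l * t ^ 2).

(* With [I x = RInt (gauss l) 0 x], the function [I ^ 2 + RInt (gauss_aux l x) 0 1]
   of [x] has derivative zero. *)
Definition gauss_aux (l x t : R) : R := exp (- l * x ^ 2 * (1 + t ^ 2)) / (l * (1 + t ^ 2)).

Lemma one_plus_sqr_pos (t : R) : 0 < 1 + t ^ 2.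
Proof. pose proof (pow2_ge_0 t). lra. Qed.

Lemma gauss_continuous (l t : R) : continuous (gauss l) t.
Proof. apply (ex_derive_continuous (V := R_NormedModule)). unfold gauss. auto_derive. easy. Qed.

Lemma gauss_aux_derive (l x t : R) : 0 < l ->
  is_derive (fun z => gauss_aux l z t) x (-2 * x * exp (- l * x ^ 2 * (1 + t ^ 2))).
Proof.
  intros Hl. unfold gauss_aux. pose proof (one_plus_sqr_pos t).
  auto_derive; [easy|]. simpl in *. field. lra.
Qed.

Lemma gauss_aux_continuous (l x t : R) : 0 < l -> continuous (gauss_aux l x) t.
Proof.
  intros Hl. apply (ex_derive_continuous (V := R_NormedModule)). unfold gauss_aux.
  pose proof (one_plus_sqr_pos t). auto_derive. simpl in *.
  apply Rgt_not_eq, Rmult_lt_0_compat; lra.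
Qed.

(** Under the integral sign, [exp (- l x^2 (1 + t^2))] factors as [gauss l x] times [gauss l (x t)],
    and the substitution [u = x t] absorbs the factor [x]. *)
Lemma RInt_gauss_aux_derive (l x : R) : 0 < l ->
  is_derive (fun x => RInt (gauss_aux l x) 0 1) x (-2 * gauss l x * RInt (gauss l) 0 x).
Proof.
  intros Hl.
  assert (E : RInt (fun t => Derive (fun u => gauss_aux l u t) x) 0 1
              = -2 * gauss l x * RInt (gauss l) 0 x).
  { rewrite (RInt_ext _ (fun t => scal (-2 * gauss l x) (scal x (gauss l (x * t + 0))))).
    2:{ intros t _. transitivity (-2 * x * exp (- l * x ^ 2 * (1 + t ^ 2))).
        - apply is_derive_unique, gauss_aux_derive, Hl.
        - change (-2 * x * exp (- l * x ^ 2 * (1 + t ^ 2))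
                  = -2 * gauss l x * (x * gauss l (x * t + 0))). unfold gauss.
          replace (- l * x ^ 2 * (1 + t ^ 2)) with (- l * x ^ 2 + - l * (x * t + 0) ^ 2) by ring.
          rewrite exp_plus. ring. }
    rewrite (RInt_scal (V := R_CompleteNormedModule)).
    - transitivity (-2 * gauss l x * RInt (gauss l) (x * 0 + 0) (x * 1 + 0)).
      2: f_equal; f_equal; ring.
      apply (f_equal (Rmult (-2 * gauss l x))).
      apply (RInt_comp_lin (V := R_CompleteNormedModule) (gauss l) x 0 0 1).
      apply (ex_RInt_continuous (V := R_CompleteNormedModule)). intros; apply gauss_continuous.
    - apply (ex_RInt_continuous (V := R_CompleteNormedModule)). intros t _.
      apply (ex_derive_continuous (V := R_NormedModule)).
      change (fun t => scal x (gauss l (x * t + 0))) with (fun t => x * gauss l (x * t + 0)).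
      unfold gauss. auto_derive. easy. }
  rewrite <- E. apply is_derive_RInt_param.
  - apply filter_forall. intros y t _. eexists. apply gauss_aux_derive, Hl.
  - intros t _. apply continuity_2d_pt_ext with (fun u v => -2 * u * exp (- l * u ^ 2 * (1 + v ^ 2))).
    { intros u v. symmetry. apply is_derive_unique, gauss_aux_derive, Hl. }
    apply continuity_2d_pt_mult.
    { apply continuity_2d_pt_mult; [apply continuity_2d_pt_const|apply continuity_2d_pt_id1]. }
    apply (continuity_1d_2d_pt_comp exp); [apply derivable_continuous_pt, derivable_pt_exp|].
    apply continuity_2d_pt_mult.
    + apply (continuity_1d_2d_pt_comp (fun u => - l * u ^ 2) (fun u _ => u)); [|apply continuity_2d_pt_id1].
      apply ex_derive_continuity_pt. auto_derive. easy.
    + apply (continuity_1d_2d_pt_comp (fun u => 1 + u ^ 2) (fun _ v => v)); [|apply continuity_2d_pt_id2].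
      apply ex_derive_continuity_pt. auto_derive. easy.
  - apply filter_forall. intros y. apply (ex_RInt_continuous (V := R_CompleteNormedModule)).
    intros; apply gauss_aux_continuous, Hl.
Qed.

Lemma RInt_gauss_aux_0 (l : R) : 0 < l -> RInt (gauss_aux l 0) 0 1 = PI / (4 * l).
Proof.
  intros Hl. apply is_RInt_unique.
  replace (PI / (4 * l)) with (minus (/ l * atan 1) (/ l * atan 0)).
  - apply (is_RInt_derive (V := R_CompleteNormedModule) (fun t => / l * atan t));
      [|intros; apply gauss_aux_continuous, Hl].
    intros t _. unfold gauss_aux. pose proof (one_plus_sqr_pos t). auto_derive; [easy|].
    replace (- l * 0 ^ 2 * (1 + t ^ 2)) with 0 by ring. rewrite exp_0. field.
    simpl in *. unfold Rsqr in *. repeat split; lra.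
  - change (/ l * atan 1 - / l * atan 0 = PI / (4 * l)). rewrite atan_1, atan_0. field. lra.
Qed.

Lemma RInt_gauss_sqr (l x : R) : 0 < l ->
  RInt (gauss l) 0 x ^ 2 + RInt (gauss_aux l x) 0 1 = PI / (4 * l).
Proof.
  intros Hl. rewrite <- RInt_gauss_aux_0 by easy.
  set (F := fun x => RInt (gauss l) 0 x ^ 2 + RInt (gauss_aux l x) 0 1).
  assert (D : forall y, is_derive F y 0).
  { intros y.
    assert (H : is_derive F y (plus (INR 2 * gauss l y * RInt (gauss l) 0 y ^ 1)
                                    (-2 * gauss l y * RInt (gauss l) 0 y))).
    { apply (is_derive_plus (V := R_NormedModule)); [|apply RInt_gauss_aux_derive, Hl].
      apply (is_derive_pow (RInt (gauss l) 0) 2), is_derive_RInt_cont.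
      intros; apply gauss_continuous. }
    replace (plus _ _) with 0 in H by (unfold plus; simpl; ring). exact H. }
  change (F x = RInt (gauss_aux l 0) 0 1).
  replace (RInt (gauss_aux l 0) 0 1) with (F 0).
  2:{ unfold F. rewrite RInt_point. change zero with 0. ring. }
  destruct (MVT_gen F 0 x (fun _ => 0)) as [c [_ Hc]].
  - intros; apply D.
  - intros y _. apply ex_derive_continuity_pt.
    eexists; apply D.
  - lra.
Qed.

Lemma RInt_gauss_aux_bound (l x : R) : 0 < l ->
  0 <= RInt (gauss_aux l x) 0 1 <= / l * gauss l x.
Proof.
  intros Hl.
  assert (EI : ex_RInt (gauss_aux l x) 0 1)
    by (apply (ex_RInt_continuous (V := R_CompleteNormedModule)); intros; apply gauss_aux_continuous, Hl).
  split.
  - apply RInt_ge_0; [lra|easy|]. intros t _. unfold gauss_aux.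
    pose proof (one_plus_sqr_pos t). apply Rlt_le, Rdiv_lt_0_compat; [apply exp_pos|].
    apply Rmult_lt_0_compat; lra.
  - replace (/ l * gauss l x) with (RInt (fun _ => / l * gauss l x) 0 1)
      by (rewrite RInt_const; unfold scal; simpl; unfold mult; simpl; ring).
    apply RInt_le; [lra|easy|apply ex_RInt_const|]. intros t _. unfold gauss_aux, gauss.
    pose proof (one_plus_sqr_pos t). pose proof (pow2_ge_0 t). pose proof (pow2_ge_0 x).
    rewrite (Rmult_comm (/ l)). unfold Rdiv. apply Rmult_le_compat.
    + apply Rlt_le, exp_pos.
    + apply Rlt_le, Rinv_0_lt_compat, Rmult_lt_0_compat; lra.
    + apply Rnot_lt_le. intros H'. apply exp_lt_inv in H'.
      assert (0 <= l * (x ^ 2 * t ^ 2))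
        by (apply Rmult_le_pos; [lra|apply Rmult_le_pos; lra]). lra.
    + apply Rinv_le_contravar; [lra|]. nra.
Qed.

Lemma gauss_lim_0 (l : R) : 0 < l -> is_lim (gauss l) p_infty 0.
Proof.
  intros Hl. apply (is_lim_comp exp (fun x => - l * x ^ 2) p_infty 0 m_infty).
  - apply is_lim_exp_m.
  - apply is_lim_le_m_loc with (fun x => - l * x).
    + exists 1. intros x Hx.
      assert (0 <= l * (x * (x - 1))) by (apply Rmult_le_pos; [lra|apply Rmult_le_pos; lra]). lra.
    + replace m_infty with (Rbar_mult (- l) p_infty).
      * apply is_lim_scal_l, is_lim_id.
      * simpl. destruct (Rle_dec 0 (- l)) as [H|H]; [exfalso; lra|]. easy.
  - exists 0. intros x _. easy.
Qed.

Lemma gauss_integral (l : R) : 0 < l ->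
  is_lim (RInt (gauss l) 0) p_infty (sqrt (PI / (4 * l))).
Proof.
  intros Hl.
  assert (LJ : is_lim (fun x => RInt (gauss_aux l x) 0 1) p_infty 0).
  { apply is_lim_le_le_loc with (fun _ => 0) (fun x => / l * gauss l x).
    - exists 0. intros x _. apply RInt_gauss_aux_bound, Hl.
    - apply is_lim_const.
    - replace (Finite 0) with (Rbar_mult (/ l) 0) by (simpl; f_equal; ring).
      apply is_lim_scal_l, gauss_lim_0, Hl. }
  apply is_lim_ext_loc with (fun x => sqrt (PI / (4 * l) - RInt (gauss_aux l x) 0 1)).
  - exists 0. intros x Hx. rewrite <- (RInt_gauss_sqr l x) by lra.
    replace (_ - _) with (Rsqr (RInt (gauss l) 0 x)) by (unfold Rsqr; ring).
    apply sqrt_Rsqr. apply RInt_ge_0; [lra| |].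
    + apply (ex_RInt_continuous (V := R_CompleteNormedModule)). intros; apply gauss_continuous.
    + intros t _. apply Rlt_le, exp_pos.
  - apply (is_lim_comp_continuous (fun x => PI / (4 * l) - RInt (gauss_aux l x) 0 1) sqrt).
    + replace (Finite (PI / (4 * l))) with (Finite (PI / (4 * l) - 0)) by (f_equal; ring).
      apply is_lim_minus'; [apply is_lim_const|easy].
    + apply continuity_pt_filterlim, continuity_pt_sqrt. apply Rlt_le, Rdiv_lt_0_compat;
      [apply PI_RGT_0|lra].
Qed.

(** * The normal distribution function *)

(** Anchored at 0, where symmetry gives [1 / 2], so as to be a proper integral; [normal_cdf_ncdf]
    identifies it with the improper one. *)
Definition ncdf (v x : R) : R := / 2 + RInt (normal_density 0 v) 0 x.

Lemma normal_density_gauss (v t : R) : 0 < v ->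
  normal_density 0 v t = / sqrt (2 * PI * v) * gauss (/ (2 * v)) t.
Proof. intros Hv. unfold normal_density, gauss. do 2 f_equal. field. lra. Qed.

Lemma normal_density_pos (v t : R) : 0 < v -> 0 < normal_density 0 v t.
Proof.
  intros Hv. apply Rmult_lt_0_compat; [|apply exp_pos].
  apply Rinv_0_lt_compat, sqrt_lt_R0. pose proof PI_RGT_0.
  apply Rmult_lt_0_compat; lra.
Qed.

Lemma normal_density_derive (v t : R) : 0 < v ->
  is_derive (normal_density 0 v) t (- t / v * normal_density 0 v t).
Proof.
  intros Hv. unfold normal_density. auto_derive; [easy|]. 
  change (- (t - 0) ^ 2 / (2 * v)) with (- ((t + - 0) * ((t + - 0) * 1)) * / (2 * v)).
  generalize (exp (- ((t + - 0) * ((t + - 0) * 1)) * / (2 * v))) as e.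
  generalize (/ sqrt (2 * PI * v)) as c. intros c e. field. lra.
Qed.

Lemma normal_density_continuous (v t : R) : 0 < v -> continuous (normal_density 0 v) t.
Proof.
  intros Hv. apply (ex_derive_continuous (V := R_NormedModule)). eexists.
  apply normal_density_derive, Hv.
Qed.

Lemma ncdf_derive (v x : R) : 0 < v -> is_derive (ncdf v) x (normal_density 0 v x).
Proof.
  intros Hv. unfold ncdf. rewrite <- (Rplus_0_l (normal_density 0 v x)).
  apply (is_derive_plus (V := R_NormedModule)); [apply (is_derive_const (V := R_NormedModule))|].
  apply is_derive_RInt_cont. intros; apply normal_density_continuous, Hv.
Qed.

Lemma ncdf_lim_p (v : R) : 0 < v -> is_lim (ncdf v) p_infty 1.
Proof.
  intros Hv. pose proof PI_RGT_0 as Hpi.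
  assert (Hl : 0 < / (2 * v)) by (apply Rinv_0_lt_compat; lra).
  assert (Hs : 0 < sqrt (2 * PI * v)) by (apply sqrt_lt_R0, Rmult_lt_0_compat; lra).
  apply is_lim_ext with (fun x => / 2 + / sqrt (2 * PI * v) * RInt (gauss (/ (2 * v))) 0 x).
  { intros x. unfold ncdf. f_equal.
    rewrite (RInt_ext (normal_density 0 v) (fun t => scal (/ sqrt (2 * PI * v)) (gauss (/ (2 * v)) t)))
      by (intros; apply normal_density_gauss, Hv).
    rewrite (RInt_scal (V := R_CompleteNormedModule)); [easy|].
    apply (ex_RInt_continuous (V := R_CompleteNormedModule)). intros; apply gauss_continuous. }
  assert (E : 1 = / 2 + / sqrt (2 * PI * v) * sqrt (PI / (4 * / (2 * v)))).
  { replace (PI / (4 * / (2 * v))) with (2 * PI * v * / 4) by (field; lra).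
    rewrite (sqrt_mult (2 * PI * v) (/ 4)), (sqrt_lem_1 (/ 4) (/ 2)); try lra.
    - field. lra.
    - apply Rmult_le_pos; lra. }
  rewrite E at 1. apply is_lim_plus'; [apply is_lim_const|].
  apply (is_lim_scal_l _ _ _ (Finite _)), gauss_integral, Hl.
Qed.

Lemma ncdf_opp (v x : R) : 0 < v -> ncdf v (- x) = 1 - ncdf v x.
Proof.
  intros Hv. unfold ncdf.
  replace (RInt (normal_density 0 v) 0 (- x)) with (- RInt (normal_density 0 v) 0 x); [field|].
  pose proof (RInt_comp_lin (V := R_CompleteNormedModule) (normal_density 0 v) (-1) 0 0 x) as H.
  replace (-1 * 0 + 0) with 0 in H by ring. replace (-1 * x + 0) with (- x) in H by ring.
  rewrite <- H.
  - rewrite <- (RInt_opp (V := R_CompleteNormedModule)).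
    + apply RInt_ext. intros t _. unfold opp, scal; simpl. unfold mult; simpl.
      unfold normal_density. replace (- (-1 * t + 0 - 0) ^ 2) with (- (t - 0) ^ 2) by ring. ring.
    + apply (ex_RInt_continuous (V := R_CompleteNormedModule)). intros; apply normal_density_continuous, Hv.
  - apply (ex_RInt_continuous (V := R_CompleteNormedModule)). intros; apply normal_density_continuous, Hv.
Qed.

Lemma ncdf_lim_m (v : R) : 0 < v -> is_lim (ncdf v) m_infty 0.
Proof.
  intros Hv. apply is_lim_ext with (fun x => 1 - ncdf v (- x)).
  { intros x. rewrite ncdf_opp by easy. ring. }
  rewrite <- (Rminus_diag 1). apply is_lim_minus'; [apply is_lim_const|].
  apply (is_lim_comp (ncdf v) Ropp m_infty 1 p_infty).
  - apply ncdf_lim_p, Hv.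
  - apply (is_lim_opp (fun x => x) m_infty m_infty), is_lim_id.
  - exists 0. intros; easy.
Qed.

Lemma normal_cdf_ncdf (v x : R) : 0 < v -> normal_cdf 0 v x = ncdf v x.
Proof.
  intros Hv. unfold normal_cdf. apply is_RInt_gen_unique.
  intros P [eps HP].
  pose proof (ncdf_lim_m v Hv) as L. apply is_lim_spec in L.
  destruct (L eps) as [M HM].
  exists (fun a => a < M) (fun b => b = x); [exists M; auto|easy|].
  intros a b Ha ->. exists (ncdf v x - ncdf v a). split.
  - apply (is_RInt_derive (V := R_CompleteNormedModule) (ncdf v)).
    + intros; apply ncdf_derive, Hv.
    + intros; apply normal_density_continuous, Hv.
  - apply HP. specialize (HM a Ha). rewrite Rminus_0_r in HM.
    change (Rabs (ncdf v x - ncdf v a - ncdf v x) < eps).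
    replace (ncdf v x - ncdf v a - ncdf v x) with (- ncdf v a) by ring.
    rewrite Rabs_Ropp. easy.
Qed.

(** * Stein's equation *)

Lemma derive_nonneg_le (f df : R -> R) (x y : R) : x <= y ->
  (forall z, is_derive f z (df z)) -> (forall z, x <= z <= y -> 0 <= df z) -> f x <= f y.
Proof.
  intros Hxy Hd Hp. destruct (MVT_gen f x y df) as [c [Hc E]].
  - intros; apply Hd.
  - intros z _. apply ex_derive_continuity_pt. eexists; apply Hd.
  - rewrite Rmin_left, Rmax_right in Hc by easy. specialize (Hp c Hc).
    assert (0 <= df c * (y - x)) by (apply Rmult_le_pos; lra). lra.
Qed.

Lemma ncdf_le (v x y : R) : 0 < v -> x <= y -> ncdf v x <= ncdf v y.
Proof.
  intros Hv Hxy. apply (derive_nonneg_le (ncdf v) (normal_density 0 v)); [easy| |].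
  - intros; apply ncdf_derive, Hv.
  - intros; apply Rlt_le, normal_density_pos, Hv.
Qed.

Lemma ncdf_bounds (v x : R) : 0 < v -> 0 <= ncdf v x <= 1.
Proof.
  intros Hv.
  assert (H : forall x, ncdf v x <= 1).
  { intros y. apply (is_lim_le_loc (fun _ => ncdf v y) (ncdf v) p_infty (ncdf v y) 1).
    - exists y. intros z Hz. apply ncdf_le; lra.
    - apply is_lim_const.
    - apply ncdf_lim_p, Hv. }
  split; [|apply H]. specialize (H (- x)). rewrite ncdf_opp in H by easy. lra.
Qed.

(** With [x] fixed, [ncdf v y + (v / x) normal_density 0 v y] is nonincreasing for [y >= x], its
    derivative being the density times [1 - y / x]. It dominates [ncdf v y], which tends to 1. *)
Lemma mills_upper (v x : R) : 0 < v -> 0 < x -> x * (1 - ncdf v x) <= v * normal_density 0 v x.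
Proof.
  intros Hv Hx.
  set (F := fun y => - (ncdf v y + v / x * normal_density 0 v y)).
  assert (HF : forall y, is_derive F y (normal_density 0 v y * (y / x - 1))).
  { intros y.
    assert (H : is_derive F y (opp (plus (normal_density 0 v y)
                  (v / x * (- y / v * normal_density 0 v y))))).
    { apply (is_derive_opp (V := R_NormedModule)), (is_derive_plus (V := R_NormedModule)).
      - apply ncdf_derive, Hv.
      - apply is_derive_scal, normal_density_derive, Hv. }
    replace (opp _) with (normal_density 0 v y * (y / x - 1)) in H; [exact H|].
    unfold opp, plus; simpl. field. lra. }
  assert (B : 1 <= ncdf v x + v / x * normal_density 0 v x).
  { apply (is_lim_le_loc (ncdf v) (fun _ => ncdf v x + v / x * normal_density 0 v x) p_infty 1
             (ncdf v x + v / x * normal_density 0 v x)).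
    - exists x. intros y Hy.
      pose proof (derive_nonneg_le F _ x y ltac:(lra) HF) as H.
      assert (H1 : F x <= F y).
      { apply H. intros z Hz. apply Rmult_le_pos; [apply Rlt_le, normal_density_pos, Hv|].
        assert (1 <= z / x); [|lra]. apply (Rmult_le_reg_r x); [easy|].
        unfold Rdiv. rewrite Rmult_assoc, Rinv_l; lra. }
      unfold F in H1. pose proof (normal_density_pos v y Hv).
      assert (0 <= v / x * normal_density 0 v y).
      { apply Rmult_le_pos; [|lra]. apply Rlt_le, Rdiv_lt_0_compat; lra. }
      lra.
    - apply ncdf_lim_p, Hv.
    - apply is_lim_const. }
  assert (E : x * (v / x * normal_density 0 v x) = v * normal_density 0 v x) by (field; lra).
  apply (Rmult_le_compat_l x) in B; lra.
Qed.

Lemma mills_lower (v x : R) : 0 < v -> x < 0 -> - x * ncdf v x <= v * normal_density 0 v x.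
Proof.
  intros Hv Hx. pose proof (mills_upper v (- x) Hv ltac:(lra)) as H.
  rewrite ncdf_opp in H by easy.
  replace (normal_density 0 v (- x)) with (normal_density 0 v x) in H; [lra|].
  unfold normal_density. replace (- (- x - 0) ^ 2) with (- (x - 0) ^ 2) by ring. easy.
Qed.

Lemma continuity_bounded (f : R -> R) (x y : R) : x <= y ->
  (forall z, continuity_pt f z) -> exists M, forall z, x <= z <= y -> Rabs (f z) <= M.
Proof.
  intros Hxy Hf. destruct (continuity_ab_maj (fun z => Rabs (f z)) x y Hxy) as [m [Hm _]].
  - intros z _. apply (continuity_pt_comp f Rabs); [apply Hf|apply Rcontinuity_abs].
  - exists (Rabs (f m)). exact Hm.
Qed.

(* The piecewise linear function equal to [1] before [a] and to [0] after [b]. *)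
Definition ramp (a b x : R) : R := (1 + (Rabs (x - b) - Rabs (x - a)) / (b - a)) / 2.

Lemma ramp_left (a b x : R) : a < b -> x <= a -> ramp a b x = 1.
Proof. intros Hab Hx. unfold ramp. rewrite !Rabs_left1 by lra. field. lra. Qed.

Lemma ramp_right (a b x : R) : a < b -> b <= x -> ramp a b x = 0.
Proof. intros Hab Hx. unfold ramp. rewrite !Rabs_right by lra. field. lra. Qed.

Lemma ramp_bounds (a b x : R) : a < b -> 0 <= ramp a b x <= 1.
Proof.
  intros Hab. destruct (Rle_dec x a) as [H|H]; [rewrite ramp_left by lra; lra|].
  destruct (Rle_dec b x) as [H'|H']; [rewrite ramp_right by lra; lra|].
  unfold ramp. rewrite (Rabs_left1 (x - b)), (Rabs_right (x - a)) by lra.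
  replace ((1 + (- (x - b) - (x - a)) / (b - a)) / 2) with ((b - x) / (b - a)) by (field; lra).
  split; [apply Rdiv_le_0_compat; lra|].
  apply (Rmult_le_reg_r (b - a)); [lra|]. unfold Rdiv. rewrite Rmult_assoc, Rinv_l; lra.
Qed.

Lemma ramp_continuous (a b x : R) : continuous (ramp a b) x.
Proof.
  assert (H : forall c, continuous (fun x => Rabs (x - c)) x).
  { intros c. apply (continuous_comp (fun x => x - c) Rabs).
    - apply (ex_derive_continuous (V := R_NormedModule)). auto_derive. easy.
    - apply continuity_pt_filterlim, Rcontinuity_abs. }
  unfold ramp, Rdiv. apply (continuous_mult (K := R_AbsRing)); [|apply continuous_const].
  apply (continuous_plus (V := R_NormedModule)); [apply continuous_const|].
  apply (continuous_mult (K := R_AbsRing)); [|apply continuous_const].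
  apply (continuous_minus (V := R_NormedModule)); apply H.
Qed.

(** The integral of [ramp] against the normal density over the half-line up to [x]; the part before
    [a], where the ramp is 1, is [ncdf v a]. At [x = b] it is the full normal mean of the ramp. *)
Definition ramp_int (v a b x : R) : R :=
  ncdf v a + RInt (fun t => ramp a b t * normal_density 0 v t) a x.

Lemma ramp_int_derive (v a b x : R) : 0 < v ->
  is_derive (ramp_int v a b) x (ramp a b x * normal_density 0 v x).
Proof.
  intros Hv. unfold ramp_int. rewrite <- (Rplus_0_l (ramp a b x * _)).
  apply (is_derive_plus (V := R_NormedModule)); [apply (is_derive_const (V := R_NormedModule))|].
  apply (is_derive_RInt_cont (fun t => ramp a b t * normal_density 0 v t)). intros t.
  apply (continuous_mult (K := R_AbsRing));
    [apply ramp_continuous|apply normal_density_continuous, Hv].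
Qed.

Lemma ramp_int_a (v a b : R) : ramp_int v a b a = ncdf v a.
Proof. unfold ramp_int. rewrite RInt_point. change zero with 0. ring. Qed.

Lemma ncdf_minus_ramp_int_derive (v a b x : R) : 0 < v ->
  is_derive (fun x => ncdf v x - ramp_int v a b x) x ((1 - ramp a b x) * normal_density 0 v x).
Proof.
  intros Hv.
  replace ((1 - ramp a b x) * normal_density 0 v x)
    with (minus (normal_density 0 v x) (ramp a b x * normal_density 0 v x))
    by (unfold minus, plus, opp; simpl; ring).
  apply (is_derive_minus (V := R_NormedModule)); [apply ncdf_derive, Hv|apply ramp_int_derive, Hv].
Qed.

Lemma ramp_int_left (v a b x : R) : 0 < v -> a < b -> x <= a -> ramp_int v a b x = ncdf v x.
Proof.
  intros Hv Hab Hx.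
  assert (H1 : ncdf v x - ramp_int v a b x <= ncdf v a - ramp_int v a b a).
  { apply (derive_nonneg_le (fun x => ncdf v x - ramp_int v a b x)
             (fun x => (1 - ramp a b x) * normal_density 0 v x)); [easy| |].
    - intros; apply ncdf_minus_ramp_int_derive, Hv.
    - intros z Hz. rewrite ramp_left by lra. lra. }
  assert (H2 : ramp_int v a b x - ncdf v x <= ramp_int v a b a - ncdf v a).
  { rewrite <- (Ropp_minus_distr (ncdf v x)), <- (Ropp_minus_distr (ncdf v a)).
    apply (derive_nonneg_le (fun x => - (ncdf v x - ramp_int v a b x))
             (fun x => opp ((1 - ramp a b x) * normal_density 0 v x))); [easy| |].
    - intros; apply (is_derive_opp (V := R_NormedModule)), ncdf_minus_ramp_int_derive, Hv.
    - intros z Hz. rewrite ramp_left by lra. unfold opp; simpl. lra. }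
  rewrite ramp_int_a in *. lra.
Qed.

Lemma ramp_int_right (v a b x : R) : 0 < v -> a < b -> b <= x ->
  ramp_int v a b x = ramp_int v a b b.
Proof.
  intros Hv Hab Hx. apply Rle_antisym.
  - apply Ropp_le_cancel.
    apply (derive_nonneg_le (fun x => - ramp_int v a b x)
             (fun x => opp (ramp a b x * normal_density 0 v x))); [easy| |].
    + intros; apply (is_derive_opp (V := R_NormedModule)), ramp_int_derive, Hv.
    + intros z Hz. rewrite ramp_right by lra. unfold opp; simpl. lra.
  - apply (derive_nonneg_le (ramp_int v a b)
             (fun x => ramp a b x * normal_density 0 v x)); [easy| |].
    + intros; apply ramp_int_derive, Hv.
    + intros z Hz. rewrite ramp_right by lra. lra.
Qed.

Lemma ramp_int_bounds (v a b : R) : 0 < v -> a < b ->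
  ncdf v a <= ramp_int v a b b <= ncdf v b.
Proof.
  intros Hv Hab. split.
  - rewrite <- (ramp_int_a v a b).
    apply (derive_nonneg_le (ramp_int v a b)
             (fun x => ramp a b x * normal_density 0 v x)); [lra| |].
    + intros; apply ramp_int_derive, Hv.
    + intros z _. apply Rmult_le_pos; [apply ramp_bounds, Hab|apply Rlt_le, normal_density_pos, Hv].
  - assert (H : ncdf v a - ramp_int v a b a <= ncdf v b - ramp_int v a b b).
    { apply (derive_nonneg_le (fun x => ncdf v x - ramp_int v a b x)
             (fun x => (1 - ramp a b x) * normal_density 0 v x)); [lra| |].
      - intros; apply ncdf_minus_ramp_int_derive, Hv.
      - intros z _. pose proof (ramp_bounds a b z Hab).
        apply Rmult_le_pos; [lra|apply Rlt_le, normal_density_pos, Hv]. }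
    rewrite ramp_int_a in H. lra.
Qed.

(** The classical solution: the integral of the centred ramp against the density up to [x], divided
    by [v] times the density. *)
Definition stein_sol (v a b x : R) : R :=
  (ramp_int v a b x - ramp_int v a b b * ncdf v x) / (v * normal_density 0 v x).

(** Read off from Stein's equation, which thus holds by algebra; that it is the derivative is
    [stein_sol_derive]. *)
Definition stein_der (v a b x : R) : R :=
  (ramp a b x - ramp_int v a b b + x * stein_sol v a b x) / v.

Lemma stein_sol_derive (v a b x : R) : 0 < v ->
  is_derive (stein_sol v a b) x (stein_der v a b x).
Proof.
  intros Hv. pose proof (normal_density_pos v x Hv) as Hp.
  set (c := ramp_int v a b b).
  assert (D1 : is_derive (fun x => ramp_int v a b x - c * ncdf v x) x
                 (minus (ramp a b x * normal_density 0 v x) (c * normal_density 0 v x))).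
  { apply (is_derive_minus (V := R_NormedModule)); [apply ramp_int_derive, Hv|].
    apply is_derive_scal, ncdf_derive, Hv. }
  assert (D2 : is_derive (fun x => v * normal_density 0 v x) x
                 (v * (- x / v * normal_density 0 v x))).
  { apply is_derive_scal, normal_density_derive, Hv. }
  assert (Hne : v * normal_density 0 v x <> 0) by (apply Rgt_not_eq, Rmult_lt_0_compat; lra).
  pose proof (is_derive_div _ _ _ _ _ D1 D2 Hne) as D. cbv beta in D.
  match type of D with is_derive _ _ ?d => replace d with (stein_der v a b x) in D end.
  - exact D.
  - unfold stein_der, stein_sol, minus, plus, opp; simpl. fold c. field. lra.
Qed.

Lemma stein_equation (v a b x : R) : 0 < v ->
  v * stein_der v a b x - x * stein_sol v a b x = ramp a b x - ramp_int v a b b.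
Proof. intros Hv. unfold stein_der. field. lra. Qed.

Lemma stein_sol_continuity (v a b x : R) : 0 < v -> continuity_pt (stein_sol v a b) x.
Proof. intros Hv. apply ex_derive_continuity_pt. eexists; apply stein_sol_derive, Hv. Qed.

Lemma stein_der_continuity (v a b x : R) : 0 < v -> continuity_pt (stein_der v a b) x.
Proof.
  intros Hv. apply continuity_pt_filterlim.
  apply (continuous_mult (K := R_AbsRing)
           (fun x => ramp a b x - ramp_int v a b b + x * stein_sol v a b x) (fun _ => / v));
    [|apply continuous_const].
  apply (continuous_plus (V := R_NormedModule)).
  - apply (continuous_minus (V := R_NormedModule)); [apply ramp_continuous|apply continuous_const].
  - apply (continuous_mult (K := R_AbsRing)); [apply continuous_id|].
    apply continuity_pt_filterlim, stein_sol_continuity, Hv.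
Qed.

(** With [c] the mean of the ramp, the numerator is [(1 - c) ncdf v x] before [a] and
    [c (1 - ncdf v x)] after [b], so the Mills bounds control [x] times the solution. As [|x| >= 1],
    they control the solution too. *)
Lemma stein_sol_tail (v a b x : R) : 0 < v -> a < b ->
  (x <= a /\ x <= -1) \/ (b <= x /\ 1 <= x) ->
  Rabs (stein_sol v a b x) <= 1 /\ Rabs (x * stein_sol v a b x) <= 1.
Proof.
  intros Hv Hab Hx.
  pose proof (normal_density_pos v x Hv) as Hp.
  assert (Hvp : 0 < v * normal_density 0 v x) by (apply Rmult_lt_0_compat; lra).
  pose proof (ramp_int_bounds v a b Hv Hab) as Hc.
  pose proof (ncdf_bounds v a Hv). pose proof (ncdf_bounds v b Hv).
  pose proof (ncdf_bounds v x Hv).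
  assert (E : exists p u, 0 <= p <= 1 /\ 0 <= u /\ Rabs x * u <= v * normal_density 0 v x
                /\ stein_sol v a b x = p * (u / (v * normal_density 0 v x))).
  { unfold stein_sol. set (c := ramp_int v a b b) in *. destruct Hx as [[Hxa Hx1]|[Hxb Hx1]].
    - exists (1 - c), (ncdf v x). rewrite ramp_int_left, Rabs_left1 by lra.
      repeat split; try lra. apply mills_lower; lra.
    - exists c, (1 - ncdf v x). rewrite ramp_int_right, Rabs_right by lra. fold c.
      repeat split; try lra. apply mills_upper; lra. }
  destruct E as [p [u [Hpp [Hu [Hxu ->]]]]].
  set (d := v * normal_density 0 v x) in *.
  assert (G1 : 0 <= Rabs x * (u / d) <= 1).
  { split.
    - apply Rmult_le_pos; [apply Rabs_pos|apply Rdiv_le_0_compat; lra].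
    - apply (Rmult_le_reg_r d); [easy|].
      replace (Rabs x * (u / d) * d) with (Rabs x * u) by (field; lra). lra. }
  assert (Hax : 1 <= Rabs x) by (destruct Hx; [rewrite Rabs_left1|rewrite Rabs_right]; lra).
  assert (G2 : 0 <= u / d) by (apply Rdiv_le_0_compat; lra).
  assert (G3 : u / d <= Rabs x * (u / d)).
  { rewrite <- (Rmult_1_l (u / d)) at 1. apply Rmult_le_compat_r; lra. }
  rewrite !Rabs_mult, (Rabs_right p), (Rabs_right (u / d)) by lra. split.
  - rewrite <- (Rmult_1_l 1). apply Rmult_le_compat; lra.
  - replace (Rabs x * (p * (u / d))) with (p * (Rabs x * (u / d))) by ring.
    rewrite <- (Rmult_1_l 1). apply Rmult_le_compat; lra.
Qed.

(** Compactness in the middle and tail bounds outside, where the definition of [stein_der] gives the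
    bound [2 / v]. *)
Lemma stein_bounded (v a b : R) : 0 < v -> a < b ->
  exists C, forall x, Rabs (stein_sol v a b x) <= C /\ Rabs (stein_der v a b x) <= C.
Proof.
  intros Hv Hab. set (x0 := Rmin a (-1)). set (x1 := Rmax b 1).
  assert (H0 : x0 <= a /\ x0 <= -1) by (split; [apply Rmin_l|apply Rmin_r]).
  assert (H1 : b <= x1 /\ 1 <= x1) by (split; [apply Rmax_l|apply Rmax_r]).
  destruct (continuity_bounded (stein_sol v a b) x0 x1) as [M1 HM1];
    [lra|intros; apply stein_sol_continuity, Hv|].
  destruct (continuity_bounded (stein_der v a b) x0 x1) as [M2 HM2];
    [lra|intros; apply stein_der_continuity, Hv|].
  assert (P1 : 0 <= M1) by (eapply Rle_trans; [apply Rabs_pos|apply (HM1 x0); lra]).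
  assert (P2 : 0 <= M2) by (eapply Rle_trans; [apply Rabs_pos|apply (HM2 x0); lra]).
  assert (Pv : 0 < 2 / v) by (apply Rdiv_lt_0_compat; lra).
  exists (M1 + M2 + 1 + 2 / v). intros x.
  destruct (Rlt_dec x x0) as [Hx|Hx]; [|destruct (Rlt_dec x1 x) as [Hx'|Hx']].
  3:{ specialize (HM1 x ltac:(lra)). specialize (HM2 x ltac:(lra)). lra. }
  all: destruct (stein_sol_tail v a b x Hv Hab ltac:(lra)) as [T1 T2]; split; [lra|].
  all: unfold stein_der; unfold Rdiv at 1; rewrite Rabs_mult, (Rabs_right (/ v))
         by (apply Rle_ge, Rlt_le, Rinv_0_lt_compat, Hv).
  all: pose proof (ramp_bounds a b x Hab); pose proof (ramp_int_bounds v a b Hv Hab);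
    pose proof (ncdf_bounds v a Hv); pose proof (ncdf_bounds v b Hv);
    pose proof (Rabs_triang (ramp a b x - ramp_int v a b b) (x * stein_sol v a b x));
    assert (Rabs (ramp a b x - ramp_int v a b b) <= 1) by (apply Rabs_le; lra);
    apply Rle_trans with (2 / v); [|lra];
    apply Rmult_le_compat_r; [apply Rlt_le, Rinv_0_lt_compat, Hv|lra].
Qed.

(** * Convergence in distribution *)

Definition rescale (r n k : nat) : R := sqrt (INR n) * (INR k / INR n - / 4 ^ r).

Lemma rescale_S (r n k : nat) : (1 <= n)%nat ->
  rescale r n (S k) = rescale r n k + / sqrt (INR n).
Proof.
  intros Hn. apply (le_INR 1) in Hn. simpl in Hn. unfold rescale. rewrite S_INR.
  assert (Hs : 0 < sqrt (INR n)) by (apply sqrt_lt_R0; lra).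
  pose proof (sqrt_sqrt (INR n) ltac:(lra)) as Hss.
  set (s := sqrt (INR n)) in *. rewrite <- Hss. field.
  split; [lra|apply pow_nonzero; lra].
Qed.

Lemma rescale_mult (r n k : nat) : (1 <= n)%nat ->
  INR k - INR n / 4 ^ r = sqrt (INR n) * rescale r n k.
Proof.
  intros Hn. apply (le_INR 1) in Hn. simpl in Hn. unfold rescale.
  rewrite <- Rmult_assoc, sqrt_sqrt by lra. field. split; [|lra]. apply pow_nonzero; lra.
Qed.

Lemma law_rescale_abs (r n : nat) : (1 <= n)%nat ->
  law r n (fun k => Rabs (rescale r n k)) <= 2.
Proof.
  intros Hn. pose proof (law_deviation r n) as H.
  rewrite (law_ext r n _ (fun k => sqrt (INR n) * Rabs (rescale r n k))) in H.
  - rewrite law_scal, (Rmult_comm 2) in H. apply Rmult_le_reg_l in H; [easy|].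
    apply sqrt_lt_R0, (lt_INR 0). lia.
  - intros k _. rewrite rescale_mult, Rabs_mult by easy. rewrite (Rabs_right (sqrt _)); [easy|].
    apply Rle_ge, sqrt_pos.
Qed.

(** The quotient is [dh] at a point within [1 / sqrt n] of [rescale r n k]. For
    [|rescale r n k| <= K] uniform continuity gives [e], on an interval reaching to [K + 1] to
    contain that point. Otherwise the trivial bound [2 C] is at most [2 C / K] times
    [|rescale r n k|], as in Markov's inequality. *)
Lemma difference_quotient_bound (r n k : nat) (h dh : R -> R) (C K e d : R) : (1 <= n)%nat ->
  (forall x, is_derive h x (dh x)) -> (forall x, Rabs (dh x) <= C) ->
  0 < K -> 0 < e -> / sqrt (INR n) < d -> d <= 1 ->
  (forall x y, - K <= x <= K + 1 -> - K <= y <= K + 1 -> Rabs (x - y) < d ->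
     Rabs (dh x - dh y) < e) ->
  Rabs (sqrt (INR n) * fdiff (fun k => h (rescale r n k)) k - dh (rescale r n k))
  <= 2 * C / K * Rabs (rescale r n k) + e.
Proof.
  intros Hn Hh HC HK He Hd Hd1 Hu. unfold fdiff. rewrite rescale_S by easy.
  set (x := rescale r n k). set (s := sqrt (INR n)) in *.
  assert (Hs : 0 < s) by (apply sqrt_lt_R0, (lt_INR 0); lia).
  assert (His : 0 < / s) by (apply Rinv_0_lt_compat, Hs).
  destruct (MVT_gen h x (x + / s) dh) as [z [Hz E]].
  { intros; apply Hh. }
  { intros; apply ex_derive_continuity_pt; eexists; apply Hh. }
  rewrite Rmin_left, Rmax_right in Hz by lra. rewrite E.
  replace (s * (dh z * (x + / s - x)) - dh x) with (dh z - dh x) by (field; lra).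
  assert (C0 : 0 <= C) by (eapply Rle_trans; [apply Rabs_pos|apply (HC 0)]).
  assert (Q : 0 <= 2 * C / K) by (apply Rdiv_le_0_compat; lra).
  destruct (Rle_dec (Rabs x) K) as [Hx|Hx].
  - pose proof (proj1 (Rabs_le_between x K) Hx).
    assert (Rabs (dh z - dh x) < e) by (apply Hu; [lra|lra|]; rewrite Rabs_right; lra).
    assert (0 <= 2 * C / K * Rabs x) by (apply Rmult_le_pos; [easy|apply Rabs_pos]). lra.
  - assert (2 * C <= 2 * C / K * Rabs x).
    { replace (2 * C) with (2 * C / K * K) at 1 by (field; lra).
      apply Rmult_le_compat_l; lra. }
    pose proof (Rabs_triang (dh z) (- dh x)) as H'. rewrite Rabs_Ropp in H'.
    pose proof (HC z). pose proof (HC x). unfold Rminus. lra.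
Qed.

Lemma law_ramp_lim (r : nat) (a b : R) : (1 <= r)%nat -> a < b ->
  is_lim_seq (fun n => law r n (fun k => ramp a b (rescale r n k)))
             (ramp_int (asym_var r) a b b).
Proof.
  intros Hr Hab.
  pose proof (asym_var_pos r Hr) as Hv.
  pose proof (asym_var_bounds r) as [_ Hv1].
  set (v := asym_var r) in *.
  destruct (stein_bounded v a b Hv Hab) as [C HC].
  assert (C0 : 0 <= C) by (eapply Rle_trans; [apply Rabs_pos|apply (HC 0)]).
  destruct (law_stein_bound r) as [D [D0 HD]].
  apply is_lim_seq_spec. intros eps. pose proof (cond_pos eps) as Heps. simpl.
  (* The mean of [|rescale r n k|] is at most 2, so the Markov term is at most [4 C / K <= eps / 4];
     [C + 1] keeps [K] positive. *)
  set (K := 16 * (C + 1) / eps).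
  assert (HK : 0 < K) by (apply Rdiv_lt_0_compat; lra).
  assert (He : 0 < eps / 4) by lra.
  destruct (@Heine_cor2 (stein_der v a b) (- K) (K + 1)
              (fun x _ => stein_der_continuity v a b x Hv) (mkposreal _ He)) as [d0 Hd0].
  simpl in Hd0. set (d := Rmin d0 1).
  assert (Hd : 0 < d) by (apply Rmin_glb_lt; [apply cond_pos|lra]).
  assert (Hd1 : d <= 1) by apply Rmin_r.
  assert (L : is_lim_seq (fun n => / sqrt (INR n)) 0).
  { apply (is_lim_seq_inv (fun n => sqrt (INR n)) p_infty); [|easy].
    apply (filterlim_comp _ _ _ INR sqrt _ (Rbar_locally p_infty)); [apply is_lim_seq_INR|].
    apply filterlim_sqrt_p. }
  apply is_lim_seq_spec in L.
  assert (Hq : 0 < eps / (12 * (D * C + 1))).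
  { apply Rdiv_lt_0_compat; [easy|]. assert (0 <= D * C) by (apply Rmult_le_pos; lra). lra. }
  destruct (L (mkposreal _ Hd)) as [N1 HN1]. destruct (L (mkposreal _ Hq)) as [N2 HN2].
  simpl in HN1, HN2.
  exists (S (Nat.max N1 N2)). intros n Hn.
  specialize (HN1 n ltac:(lia)). specialize (HN2 n ltac:(lia)).
  assert (Hn1 : (1 <= n)%nat) by lia.
  set (s := sqrt (INR n)) in *.
  assert (Hs : 1 <= s).
  { unfold s. rewrite <- sqrt_1. apply sqrt_le_1_alt, (le_INR 1), Hn1. }
  assert (His : 0 < / s) by (apply Rinv_0_lt_compat; lra).
  rewrite Rminus_0_r, Rabs_right in HN1, HN2 by lra.
  set (h := stein_sol v a b) in *. set (dh := stein_der v a b) in *.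
  set (f := fun k => h (rescale r n k)).
  assert (Hdh : forall x, is_derive h x (dh x)) by (intros; apply stein_sol_derive, Hv).
  assert (B1 : forall k, Rabs (f k) <= C) by (intros; apply HC).
  (* Differences of order [1 / s] offset the factor [sqrt n + 1] in [law_stein_bound]: the error
     there is at most [3 D C], and [3 D C / s] after division by [s]. *)
  assert (B2 : forall k, Rabs (fdiff f k) <= C / s).
  { intros k. unfold fdiff, f. rewrite rescale_S by easy. fold s.
    destruct (MVT_gen h (rescale r n k) (rescale r n k + / s) dh) as [z [_ E]].
    { intros; apply Hdh. }
    { intros; apply ex_derive_continuity_pt; eexists; apply Hdh. }
    rewrite E. replace (_ + / s - _) with (/ s) by ring.
    rewrite Rabs_mult, (Rabs_right (/ s)) by lra.
    apply Rmult_le_compat_r; [lra|apply HC]. }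
  pose proof (HD n f C (C / s) B1 B2) as S1. fold v s in S1.
  assert (S2 : Rabs (law r n (fun k => rescale r n k * f k)
                     - v * law r n (fun k => s * fdiff f k)) <= 3 * D * C * / s).
  { rewrite (law_ext r n _ (fun k => s * (rescale r n k * f k))) in S1
      by (intros; rewrite rescale_mult by easy; unfold s; ring).
    rewrite !law_scal in *.
    set (U := law r n (fun k => rescale r n k * f k)) in *. set (V := law r n (fdiff f)) in *.
    assert (Hss : INR n = s * s) by (unfold s; rewrite sqrt_sqrt; [easy|apply pos_INR]).
    rewrite Hss in S1.
    replace (s * U - v * (s * s) * V) with (s * (U - v * (s * V))) in S1 by ring.
    rewrite Rabs_mult, (Rabs_right s) in S1 by lra.
    apply (Rmult_le_reg_l s); [lra|].
    eapply Rle_trans; [apply S1|].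
    replace (s * (3 * D * C * / s)) with (3 * D * C) by (field; lra).
    assert (C / s * (s + 1) <= 2 * C).
    { replace (C / s * (s + 1)) with (C + C * / s) by (field; lra).
      assert (/ s <= 1) by (rewrite <- Rinv_1; apply Rinv_le_contravar; lra).
      assert (C * / s <= C * 1) by (apply Rmult_le_compat_l; lra). lra. }
    replace (3 * D * C) with (D * (3 * C)) by ring. apply Rmult_le_compat_l; lra. }
  assert (S3 : Rabs (law r n (fun k => s * fdiff f k) - law r n (fun k => dh (rescale r n k)))
               <= eps / 2).
  { rewrite <- law_minus. eapply Rle_trans.
    - apply law_bound with (g := fun k => 2 * C / K * Rabs (rescale r n k) + eps / 4).
      intros k _. apply (difference_quotient_bound r n k h dh C K (eps / 4) d); auto.
      + intros; apply HC.
      + intros x y Hx Hy Hxy. apply Hd0; [easy..|]. eapply Rlt_le_trans; [apply Hxy|apply Rmin_l].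
    - rewrite law_plus, law_scal, law_const.
      assert (Q : 0 <= 2 * C / K) by (apply Rdiv_le_0_compat; lra).
      pose proof (law_rescale_abs r n Hn1) as A.
      apply (Rmult_le_compat_l _ _ _ Q) in A.
      assert (2 * C / K * 2 <= eps / 4); [|lra].
      unfold K. replace (2 * C / (16 * (C + 1) / eps) * 2) with (eps / 4 * (C / (C + 1)))
        by (field; lra).
      rewrite <- (Rmult_1_r (eps / 4)) at 2. apply Rmult_le_compat_l; [lra|].
      apply (Rmult_le_reg_r (C + 1)); [lra|]. unfold Rdiv. rewrite Rmult_assoc, Rinv_l; lra. }
  (* Stein's equation averaged over the law of the branch number. *)
  assert (E : law r n (fun k => ramp a b (rescale r n k)) - ramp_int v a b b
    = v * law r n (fun k => dh (rescale r n k)) - law r n (fun k => rescale r n k * f k)).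
  { rewrite <- law_scal, <- law_minus. rewrite <- (law_const r n (ramp_int v a b b)) at 1.
    rewrite <- law_minus. apply law_ext. intros k _. unfold f, h, dh.
    rewrite stein_equation by easy. easy. }
  rewrite E.
  set (U := law r n (fun k => rescale r n k * f k)) in *.
  set (V := law r n (fun k => s * fdiff f k)) in *.
  set (W := law r n (fun k => dh (rescale r n k))) in *.
  assert (S4 : 3 * D * C * / s < eps / 2).
  { assert (P : 0 <= D * C) by (apply Rmult_le_pos; lra).
    apply Rle_lt_trans with (3 * (D * C) * (eps / (12 * (D * C + 1)))).
    - replace (3 * D * C) with (3 * (D * C)) by ring. apply Rmult_le_compat_l; lra.
    - apply (Rmult_lt_reg_r (12 * (D * C + 1))); [lra|].
      replace (3 * (D * C) * (eps / (12 * (D * C + 1))) * (12 * (D * C + 1)))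
        with (3 * (D * C) * eps) by (field; lra).
      assert (0 <= D * C * eps) by (apply Rmult_le_pos; lra). lra. }
  assert (S5 : Rabs (v * (V - W)) <= eps / 2).
  { rewrite Rabs_mult, (Rabs_right v) by lra. rewrite <- (Rmult_1_l (eps / 2)).
    apply Rmult_le_compat; [lra|apply Rabs_pos|lra|easy]. }
  replace (v * W - U) with (- ((U - v * V) + v * (V - W))) by ring.
  rewrite Rabs_Ropp. pose proof (Rabs_triang (U - v * V) (v * (V - W))). lra.
Qed.

Lemma prob_le_law (r n : nat) (g : nat -> R) (x : R) : (1 <= n)%nat ->
  prob_le n (fun t => g (branches (S r) t)) x
  = law r n (fun k => if Rle_dec (g k) x then 1 else 0).
Proof.
  intros Hn. unfold prob_le. rewrite lsum_filter. fold (num_trees n).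
  set (f := fun k => if Rle_dec (g k) x then 1 else 0).
  transitivity (tsum n (fun t => f (branches (S r) t)) / num_trees n).
  - f_equal. apply lsum_ext. intros t _. unfold f. destruct (Rle_dec _ _); easy.
  - rewrite (tsum_branches r n f) by easy. unfold law. field. pose proof (num_trees_pos n Hn). lra.
Qed.

Theorem theorem3 (r : nat) (hr : (1 <= r)%nat) :
  conv_dist_normal
    (fun n t => sqrt (INR n) * (INR (branches (S r) t) / INR n - / 4 ^ r))
    0 (/ 3 * ((4 ^ r - 1) / 16 ^ r)).
Proof.
  intros x. fold (asym_var r). set (v := asym_var r).
  assert (Hv : 0 < v) by apply asym_var_pos, hr.
  rewrite normal_cdf_ncdf by easy.
  apply is_lim_seq_spec. intros eps. pose proof (cond_pos eps) as Heps. simpl.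
  assert (Hc : continuous (ncdf v) x).
  { apply (ex_derive_continuous (V := R_NormedModule)). eexists. apply ncdf_derive, Hv. }
  assert (He : 0 < eps / 2) by lra.
  destruct (proj1 (filterlim_locally (ncdf v) (ncdf v x)) Hc (mkposreal _ He)) as [d Hd].
  pose proof (cond_pos d) as Hdpos.
  (* Half of [eps] pays for the width [d / 2] of the ramps, through continuity of the limit; the
     other half for the convergence of their means. *)
  assert (Hup : Rabs (ncdf v (x + d / 2) - ncdf v x) < eps / 2).
  { apply Hd. change (Rabs (x + d / 2 - x) < d). rewrite Rabs_right; lra. }
  assert (Hlo : Rabs (ncdf v (x - d / 2) - ncdf v x) < eps / 2).
  { apply Hd. change (Rabs (x - d / 2 - x) < d). rewrite Rabs_left; lra. }
  apply Rabs_lt_between in Hup, Hlo.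
  (* The indicator of the half-line up to [x] lies below the ramp that descends after [x] and above
     the one that descends before [x]. *)
  pose proof (law_ramp_lim r x (x + d / 2) hr ltac:(lra)) as L1.
  pose proof (law_ramp_lim r (x - d / 2) x hr ltac:(lra)) as L2.
  apply is_lim_seq_spec in L1, L2.
  destruct (L1 (mkposreal _ He)) as [N1 HN1]. destruct (L2 (mkposreal _ He)) as [N2 HN2].
  simpl in HN1, HN2. exists (S (Nat.max N1 N2)). intros n Hn.
  specialize (HN1 n ltac:(lia)). specialize (HN2 n ltac:(lia)).
  apply Rabs_lt_between in HN1, HN2. fold v in HN1, HN2.
  pose proof (ramp_int_bounds v x (x + d / 2) Hv ltac:(lra)).
  pose proof (ramp_int_bounds v (x - d / 2) x Hv ltac:(lra)).
  change (fun t => sqrt (INR n) * (INR (branches (S r) t) / INR n - / 4 ^ r))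
    with (fun t => rescale r n (branches (S r) t)).
  rewrite prob_le_law by lia.
  set (F := law r n _).
  assert (U1 : F <= law r n (fun k => ramp x (x + d / 2) (rescale r n k))).
  { apply law_le. intros k _. destruct (Rle_dec _ _).
    - rewrite ramp_left; lra.
    - apply ramp_bounds. lra. }
  assert (U2 : law r n (fun k => ramp (x - d / 2) x (rescale r n k)) <= F).
  { apply law_le. intros k _. destruct (Rle_dec _ _).
    - apply ramp_bounds. lra.
    - rewrite ramp_right; lra. }
  apply Rabs_lt_between. lra.
Qed.
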